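(* Let $G$ be an undirected connected graph with $N$ nodes, $M$ edges and incidence matrix $D\in\mathbb{R}^{N\times M}$. For $i=1,\dots,N$ let $f_i,g_i,h_i$ be locally Lipschitz maps with $f_i(\mathbf 0)=\mathbf 0$, $h_i(\mathbf 0)=\mathbf 0$, $g_i(\mathbf 0)$ of full column rank, such that the strict passivity assumption given in the context holds. Let $v:\mathbb{R}_+\to\mathbb{R}^p$ be a bounded and piecewise continuous function and let $\Delta$ be a positive number. Then any Krasowskii solution $(x(t),\xi(t))$ to the closed-loop system $$\dot x=h(\xi)+\mathbf 1_N\otimes v,\qquad \dot\xi=f(\xi)-g(\xi)(D\otimes I_p)\,\mathsf q(z),\qquad z=(D^T\otimes I_p)x,$$ converges to the set $$\{(x,\xi):\ \xi=\mathbf 0,\ z\in \mathcal A_1\times\cdots\times\mathcal A_M,\ z=(D^T\otimes I_p)x\},$$ where $\mathcal A_k=[-\Delta/2,\Delta/2]^p\subset\mathbb{R}^p$ for $k=1,\dots,M$. Moreover, $\lim_{t\to+\infty}[\dot x(t)-\mathbf 1_N\otimes v(t)]=\mathbf 0$.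
   Context: Incidence matrix: each edge $k$ of the undirected graph $G$ has one end labelled positive and the other negative (arbitrarily); $D=(d_{ik})$ with $d_{ik}=+1$ if node $i$ is the positive end of edge $k$, $-1$ if it is the negative end, $0$ otherwise. $\otimes$ is the Kronecker product; $\mathbf 1_N$ is the all-ones vector in $\mathbb{R}^N$. Maps: $f_i:\mathbb{R}^{n_i}\to\mathbb{R}^{n_i}$, $g_i:\mathbb{R}^{n_i}\to\mathbb{R}^{n_i\times p}$, $h_i:\mathbb{R}^{n_i}\to\mathbb{R}^p$. With $\xi=(\xi_1^T,\dots,\xi_N^T)^T$, $\xi_i\in\mathbb{R}^{n_i}$, and $x=(x_1^T,\dots,x_N^T)^T$, $x_i\in\mathbb{R}^p$: $f(\xi)$ is the stacked vector of the $f_i(\xi_i)$, $h(\xi)$ the stacked vector of the $h_i(\xi_i)$, and $g(\xi)$ the block-diagonal matrix with blocks $g_i(\xi_i)$. Strict passivity assumption: for each $i$ there is a continuously differentiable, positive definite, radially unbounded function $S_i:\mathbb{R}^{n_i}\to\mathbb{R}_+$ such that $\nabla S_i(\xi_i)(f_i(\xi_i)+g_i(\xi_i)u_i)\le -W_i(\xi_i)+h_i(\xi_i)^Tu_i$ for all $\xi_i\in\mathbb{R}^{n_i}$, $u_i\in\mathbb{R}^p$, where $W_i$ is continuous, zero at the origin and positive elsewhere. Quantizer: $\mathsf q(r)=\Delta\lfloor r/\Delta+1/2\rfloor$ for $r\in\mathbb{R}$; for vectors, $\mathsf q$ is applied componentwise. Krasowskii solutions: for $\dot X=F(t,X)$ with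 possibly discontinuous $F$, a Krasowskii solution on an interval $I$ is an absolutely continuous function satisfying $\dot X(t)\in\mathcal K(F(t,X(t))):=\bigcap_{\delta>0}\overline{\mathrm{co}}\,F(t,B(X(t),\delta))$ for a.e. $t\in I$, where $B(X,\delta)$ is the ball of radius $\delta$ centred at $X$ and $\overline{\mathrm{co}}$ is the closed convex hull. Asymptotic statements refer to solutions on $[0,+\infty)$; $\dot x(t)$ is understood at the times (almost all) at which the derivative exists; convergence to a set means that the distance to the set tends to $0$ as $t\to+\infty$.
   Formalization: The final limit is taken over the times at which the derivative of x exists and v is continuous; isolated breakpoints of v, where v(t) may be altered arbitrarily without affecting the solution, are left out because the claim can fail there. *)

(* Defs.v *)
From HB Require Import structures.
From mathcomp Require Import all_boot all_order all_algebra.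
From mathcomp Require Import all_classical all_reals all_analysis.

Set Implicit Arguments.
Unset Strict Implicit.
Unset Printing Implicit Defensive.

Import Order.TTheory GRing.Theory Num.Theory.
Import numFieldNormedType.Exports.

Local Open Scope classical_set_scope.
Local Open Scope ring_scope.

Record ugraph (N M : nat) := UGraph {
  edge : 'I_M -> {set 'I_N};
  card_edge : forall k, #|edge k| = 2%N;
  edge_inj : injective edge }.

Definition adjacent N M (G : ugraph N M) : rel 'I_N :=
  fun i j => [exists k, edge G k == [set i; j]%SET].

Definition connected_graph N M (G : ugraph N M) : Prop :=
  forall i j, connect (adjacent G) i j.

Definition incidence_matrix (R : realType) N M (G : ugraph N M)
    (D : 'M[R]_(N, M)) : Prop :=
  exists pos neg : 'I_M -> 'I_N,
    (forall k, edge G k = [set pos k; neg k]%SET) /\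
    D = \matrix_(i, k) (if i == pos k then 1
                        else if i == neg k then -1 else 0).

(* Block vectors and matrices use the \mxcol / \mxblock encoding, so that the  *)
(* dimensions are the (locked) sums of the block sizes.                        *)
Definition kron (R : realType) m n p q (A : 'M[R]_(m, n)) (B : 'M[R]_(p, q)) :
    'M[R]_(\sum_(i < m) p, \sum_(j < n) q) :=
  \mxblock_(i < m, j < n) (A i j *: B).

(* Kronecker product of two column vectors: kron would give a vector of width  *)
(* \sum_(j < 1) 1, which is not convertible to 1.                              *)
Definition kron_col (R : realType) m p (a : 'cV[R]_m) (b : 'cV[R]_p) :
    'cV[R]_(\sum_(i < m) p) :=
  \mxcol_(i < m) (a i ord0 *: b).

Section Vector_functions.
Context {R : realType}.

Definition grad n (S : 'cV[R]_n -> R) (a : 'cV[R]_n) : 'rV[R]_n :=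
  \row_j 'D_(delta_mx j ord0) S a.

Definition continuously_differentiable n (S : 'cV[R]_n -> R) : Prop :=
  (forall a, differentiable S a) /\ continuous (grad S).

Definition positive_definite (V : normedModType R) (S : V -> R) : Prop :=
  S 0 = 0 /\ forall a, a != 0 -> 0 < S a.

Definition radially_unbounded (V : normedModType R) (S : V -> R) : Prop :=
  forall C, exists r : R, forall a, r <= `|a| -> C <= S a.

Definition strictly_passive n p (f : 'cV[R]_n -> 'cV[R]_n)
    (g : 'cV[R]_n -> 'M[R]_(n, p)) (h : 'cV[R]_n -> 'cV[R]_p) : Prop :=
  exists S W : 'cV[R]_n -> R,
    [/\ [/\ continuously_differentiable S, positive_definite S
          & radially_unbounded S],
        [/\ continuous W, W 0 = 0 & forall a, a != 0 -> 0 < W a]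
      & forall (xi : 'cV[R]_n) (u : 'cV[R]_p),
          (grad S xi *m (f xi + g xi *m u)) ord0 ord0
            <= - W xi + ((h xi)^T *m u) ord0 ord0].

(* A function on R_+ is a function on R whose values at negative times are     *)
(* irrelevant; 0 may always be listed among the breakpoints.                   *)
Definition piecewise_continuous (V : normedModType R) (v : R -> V) : Prop :=
  [/\ forall T : R, exists s : seq R,
        forall t, 0 <= t <= T -> t \notin s -> {for t, continuous v},
      forall t, 0 <= t -> cvg (v x @[x --> t^'+])
    & forall t, 0 < t -> cvg (v x @[x --> t^'-])].

(* A solution x of x' = h(xi) + 1 (x) v may also be differentiable at a        *)
(* breakpoint t of v where both one-sided limits agree and differ from v(t);   *)
(* there x'(t) is unrelated to v(t), so breakpoints of v are left out.         *)
Definition derivative_times (V W : normedModType R) (x : R -> V) (v : R -> W) :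
    set R :=
  [set t | derivable x t 1 /\ {for t, continuous v}].

Definition quantizer (Delta r : R) : R :=
  Delta * (Num.floor (r / Delta + 1 / 2))%:~R.

End Vector_functions.

Section Krasowskii.
Context {R : realType} {V : normedModType R}.

Definition closed_convex_hull (A : set V) : set V :=
  smallest (fun B : set V => closed B /\ convex_set (M := V) B) A.

(* The norm of V is the maximum norm for matrices and pairs; the intersection  *)
(* over delta is the same for every equivalent norm.                           *)
Definition krasowskii (F : V -> V) (X : V) : set V :=
  \bigcap_(delta in [set d : R | 0 < d]) closed_convex_hull (F @` ball X delta).

Definition abs_continuous (a b : R) (X : R -> V) : Prop :=
  forall e : R, 0 < e -> exists2 d : R, 0 < d &
    forall n (s t : 'I_n -> R),
      (forall i, [/\ a <= s i, s i <= t i & t i <= b]) ->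
      trivIset setT (fun i => `]s i, t i[%classic) ->
      \sum_(i < n) (t i - s i) < d ->
      \sum_(i < n) `|X (t i) - X (s i)| < e.

(* On an interval that is not compact, absolute continuity is required on      *)
(* every compact subinterval.                                                  *)
Definition krasowskii_solution (F : R -> V -> V) (I : interval R)
    (X : R -> V) : Prop :=
  (forall a b, a \in I -> b \in I -> abs_continuous a b X) /\
  {ae (@lebesgue_measure R), forall t, t \in I ->
     derivable X t 1 /\ krasowskii (F t) (X t) (derive1 X t)}.

End Krasowskii.

Section Closed_loop.
Context {R : realType} {N M p : nat} {n : 'I_N -> nat}.
Variable D : 'M[R]_(N, M).

Local Notation xT := 'cV[R]_(\sum_(i < N) p).
Local Notation xiT := 'cV[R]_(\sum_(i < N) n i).
Local Notation zT := 'cV[R]_(\sum_(k < M) p).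

Definition stack_f (f : forall i, 'cV[R]_(n i) -> 'cV[R]_(n i)) (xi : xiT) :
    xiT :=
  \mxcol_(i < N) f i (submxcol xi i).

Definition stack_h (h : forall i, 'cV[R]_(n i) -> 'cV[R]_p) (xi : xiT) : xT :=
  \mxcol_(i < N) h i (submxcol xi i).

Definition diag_g (g : forall i, 'cV[R]_(n i) -> 'M[R]_(n i, p)) (xi : xiT) :
    'M[R]_(\sum_(i < N) n i, \sum_(i < N) p) :=
  \mxblock_(i < N, j < N) (if i == j then g i (submxcol xi i) else 0).

Definition relative (x : xT) : zT := kron D^T (1%:M : 'M[R]_p) *m x.

Definition closed_loop (f : forall i, 'cV[R]_(n i) -> 'cV[R]_(n i))
    (g : forall i, 'cV[R]_(n i) -> 'M[R]_(n i, p))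
    (h : forall i, 'cV[R]_(n i) -> 'cV[R]_p) (v : R -> 'cV[R]_p) (Delta : R)
    (t : R) (X : xT * xiT) : xT * xiT :=
  let: (x, xi) := X in
  (stack_h h xi + kron_col (const_mx 1 : 'cV[R]_N) (v t),
   stack_f f xi - diag_g g xi *m kron D (1%:M : 'M[R]_p)
                    *m map_mx (quantizer Delta) (relative x)).

Definition hypercube (Delta : R) : set 'cV[R]_p :=
  [set w | forall j, w j ord0 \in `[- (Delta / 2), Delta / 2]].

Definition limit_set (Delta : R) : set (xT * xiT) :=
  [set X | X.2 = 0 /\
     forall k : 'I_M, hypercube Delta (submxcol (relative X.1) k)].

End Closed_loop.

(* Main.v *)
(* A quantizer is the subgradient of a convex primitive Q >= 0, with          *)

(* Write [B] for [kron D 1%:M] and [P] for [potential]. Since [B^T] annihilates vectors constant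
   over the nodes, [v] drops out of [z' = B^T h(xi)], and the loop is a strictly passive system in
   feedback with an integrator whose storage is the convex function [P(z)].

   No element of a Krasowskii hull is ever selected. A linear functional that is bounded on all
   values of the field by a continuous function of the state obeys the same bound on the hull
   ([krasowskii_le]). For a row [r] and [tau > 0], the subgradient inequality of [P] gives such a
   bound: [r xi' <= r f(xi) + (P(z - tau y) - P(z)) / tau] with [y = B^T (r g(xi))^T]
   ([krasowskii_loop_snd]). The proof then consists in choosing [r].

   For [r = grad S(xi)], passivity forces [r g = h^T], so [y = z'] and the quotient compensates the
   growth of [P(z)]: the storage [S(xi) + P(z)] falls at rate at least [w] while [W(xi) >= w]
   ([storage_rate]). Hence [xi] and [z] are bounded, [xi] is Lipschitz ([xi_lipschitz]), [xi] tends
   to 0 ([xi_cvg0]) and [z] varies slowly ([z_slow]).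

   For the constant row [r = (A z(t))^T L], with [B^T A z = z] and [L g(0) = 1], the vector [y]
   stays close to [z] on [[t, t + 1]], so [tau = 1] gives [r xi' <= o(1) - P(z)]. As [r xi] tends to
   0, so does [P(z)], and [P(z) >= Delta (|z| - Delta / 2)] brings [z] to the cube ([z_cvg]).

   Slopes become increments through [abs_continuous_rate], and [derive1_x] recovers the equation for
   [x'] at individual times. *)
(* Q(r) >= Delta (|r| - Delta/2). Along a solution, V = sum_i S_i(xi_i) +     *)
(* sum_j Q(z_j) has left upper derivative at most - sum_i W_i(xi_i) almost    *)
(* everywhere: passivity cancels the cross term, and the Krasowskii inclusion *)
(* is tested only against linear functionals, the subgradient inequality for  *)
(* Q replacing any choice of an element of the convexified quantizer. Hence   *)
(* V decreases, z and xi are bounded, and Barbalat's argument gives xi -> 0,  *)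
(* so x' - v = h(xi) -> 0 and z varies slowly. For z, freeze t0 and write     *)
(* z(t0) = D^T A z(t0) and L g(0) = I; testing xi' against the constant row   *)
(* (A z(t0))^T L bounds its increment over [t0, t0 + 1] by o(1) - Q(z(t0)).   *)
(* As xi -> 0, this forces Q(z(t0)) -> 0, that is, |z| -> [0, Delta/2].       *)
Require Import Defs.
From mathcomp Require Import all_boot all_order all_algebra.
From mathcomp Require Import all_classical all_reals all_analysis.
From mathcomp Require Import ring lra.
Import Order.TTheory GRing.Theory Num.Theory.
Import numFieldNormedType.Exports.
Local Open Scope classical_set_scope.
Local Open Scope ring_scope.

(** * Absolutely continuous functions with a slope bound almost everywhere *)

Section Abs_continuous.
Context {R : realType}.

Lemma ae_impl (P Q : R -> Prop) : (forall t, P t -> Q t) ->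
  {ae (@lebesgue_measure R), forall t, P t} ->
  {ae (@lebesgue_measure R), forall t, Q t}.
Proof. by move=> PQ; apply: negligibleS => t; apply: contra_not; exact: PQ. Qed.

(** An upper left Dini derivative: [P(z)] need not be differentiable along a solution, and a
    backward step matches the subgradient quotient. *)
Definition left_slope_le (u : R -> R) (t c : R) : Prop :=
  forall e, 0 < e -> exists2 d, 0 < d &
    forall s, t - d < s -> s <= t -> u t - u s <= (c + e) * (t - s).

(** [U] will be an open set of small measure around the exceptional times; [w] is variation of [u]
    incurred inside it, to be charged to absolute continuity. *)
Definition covered_variation (U : set R) (u : R -> R) (t b w : R) : Prop :=
  exists n, exists s r : 'I_n -> R,
    [/\ forall i, [/\ t <= s i, s i <= r i & r i <= b],
        forall i, `]s i, r i[%classic `<=` U,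
        trivIset setT (fun i => `]s i, r i[%classic)
      & w = \sum_(i < n) `|u (r i) - u (s i)|].

Lemma covered_variation0 U u t b : covered_variation U u t b 0.
Proof.
exists 0%N, (fun=> 0), (fun=> 0); split; try by case.
by rewrite big_ord0.
Qed.

Lemma covered_variation_le U u t t' b w : t' <= t ->
  covered_variation U u t b w -> covered_variation U u t' b w.
Proof.
move=> t't [n [s [r [sr srU triv ->]]]]; exists n, s, r; split=> // i.
by have [ts ? ?] := sr i; split=> //; exact: le_trans ts.
Qed.

Lemma covered_variation_cons U u t t' b w : t' <= t -> t <= b ->
  `]t', t[%classic `<=` U -> covered_variation U u t b w ->
  covered_variation U u t' b (w + `|u t - u t'|).
Proof.
move=> t't tb t'tU [n [s [r [sr srU triv ->]]]].
pose s' (i : 'I_n.+1) := if unlift ord0 i is Some j then s j else t'.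
pose r' (i : 'I_n.+1) := if unlift ord0 i is Some j then r j else t.
exists n.+1, s', r'; split.
- move=> i; rewrite /s' /r'; case: unliftP => [j _|_]; last by split.
  by have [ts ? ?] := sr j; split=> //; exact: le_trans ts.
- by move=> i; rewrite /s' /r'; case: unliftP.
- move=> i j _ _ [x []] /=; rewrite /s' /r' !in_itv /=.
  case: unliftP => [i' ->|->]; case: unliftP => [j' ->|->] //.
  + move=> xi xj; congr lift; apply: triv => //; exists x.
    by split; rewrite /= in_itv.
  + move=> /andP[sx _] /andP[_ xt]; have [tsi _ _] := sr i'.
    by have := lt_trans sx xt; rewrite ltNge tsi.
  + move=> /andP[_ xt] /andP[sx _]; have [tsj _ _] := sr j'.
    by have := lt_trans sx xt; rewrite ltNge tsj.
- rewrite big_ord_recl addrC /s' /r' unlift_none; congr (_ + _).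
  by apply: eq_bigr => i _; rewrite liftK.
Qed.

Lemma covered_variation_length (U : set R) (n : nat) (s r : 'I_n -> R) :
  open U -> (forall i, s i <= r i) -> (forall i, `]s i, r i[%classic `<=` U) ->
  trivIset setT (fun i => `]s i, r i[%classic) ->
  ((\sum_(i < n) (r i - s i))%:E <= lebesgue_measure U)%E.
Proof.
move=> oU sr srU triv.
have -> : (\sum_(i < n) (r i - s i))%:E
    = lebesgue_measure (\big[setU/set0]_(i < n) `]s i, r i[%classic).
  rewrite measure_bigsetU_ord// -sumEFin; apply: eq_bigr => i _.
  have /= -> := lebesgue_measure_itv (R := R) `]s i, r i[; rewrite lte_fin.
  by case: ltgtP (sr i) => // ->; rewrite subrr.
apply: le_measure; rewrite ?inE.
- by apply: bigsetU_measurable => i _; exact: measurable_itv.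
- exact: measurable_realfun.open_measurable.
- by apply: (big_ind (fun A => A `<=` U)) => // A B AU BU x [/AU|/BU].
Qed.

Lemma abs_continuous_near {V : normedModType R} (a b : R) (X : R -> V) (t : R) :
  abs_continuous a b X -> a <= t <= b ->
  forall e, 0 < e -> exists2 d, 0 < d &
    forall s, a <= s <= b -> `|s - t| < d -> `|X s - X t| < e.
Proof.
move=> acX /andP[at_ tb] e e0; have [d d0 dX] := acX e e0; exists d => // s.
move=> /andP[as_ sb] std.
have ordered s1 s2 : a <= s1 -> s1 <= s2 -> s2 <= b -> s2 - s1 < d ->
    `|X s2 - X s1| < e.
  move=> as1 s12 s2b s12d.
  have := dX 1%N (fun=> s1) (fun=> s2); rewrite !big_ord1; apply=> //.
  by move=> i j _ _ _; rewrite (ord1 i) (ord1 j).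
have [st|/ltW ts] := leP s t.
- by rewrite distrC ordered// -(ger0_norm (x := t - s)) ?subr_ge0// distrC.
- by rewrite ordered// -(ger0_norm (x := s - t)) ?subr_ge0.
Qed.

(* Backward induction on t: off the null set the slope bound gives a step to  *)
(* the left of t; on it, t lies in an open U of small measure, and the        *)
(* increments of u over disjoint intervals of U are small in total.           *)
Lemma abs_continuous_nonincr (a b : R) (u : R -> R) : a <= b ->
  abs_continuous a b u ->
  {ae (@lebesgue_measure R),
    forall t, a < t -> t <= b -> left_slope_le u t 0} ->
  u b <= u a.
Proof.
move=> ab acu aeu; apply/ler_addgt0Pr => e0 e0_gt0.
(* The error [e0] splits as [e * (b - a)], spent on slopes off the null set, plus [e], spent on
   variation inside [U]. *)
pose e := e0 / (b - a + 1).
have ba1 : 0 < b - a + 1 by rewrite ltr_wpDl// subr_ge0.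
have e_gt0 : 0 < e by rewrite divr_gt0.
suff key : forall h, 0 < h -> u b - u a <= e * (b - a) + e + h.
  rewrite -lerBlDl; have -> : e0 = e * (b - a) + e.
    by rewrite -[X in _ + X]mulr1 -mulrDr divfK ?gt_eqF.
  by apply/ler_addgt0Pr => h; exact: key.
have [d d_gt0 acud] := acu e e_gt0.
move/negligible_outer_measure: aeu => E0.
have d2 : 0 < d / 2 by rewrite divr_gt0.
have [U [oU EU]] := outer_measure_open_le (~` [set t | a < t -> t <= b ->
  left_slope_le u t 0]) d2.
rewrite E0 add0e => Ud.
have small w : covered_variation U u a b w -> w < e.
  move=> [n [s [r [sr srU triv ->]]]]; apply: acud => //.
  have := covered_variation_length _ _ s r oU _ srU triv.
  move=> /(_ (fun i => let: And3 _ h _ := sr i in h)) /le_trans /(_ Ud).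
  by rewrite lee_fin => /le_lt_trans; apply; rewrite ltr_pdivrMr// ltr_pMr// ltr1n.
(* The slack [h] lets [P] pass to an infimum of times by continuity of [u], where [w] need not be
   attained in a limit. *)
pose P t := forall h, 0 < h -> exists2 w, covered_variation U u t b w &
  u b - u t <= e * (b - t) + w + h.
suff : P a.
  move=> Pa h /Pa[w /small we]; move/le_trans; apply.
  by rewrite lerD2r lerD2l ltW.
pose S := [set t | a <= t <= b /\ P t].
have Sb : S b.
  split; first by rewrite ab lexx.
  move=> h h0; exists 0; first exact: covered_variation0.
  by rewrite !subrr mulr0 !add0r ltW.
have infS : has_inf S by split; [exists b|exists a => t [/andP[]]].
pose tau := inf S.
have tau_le t : S t -> tau <= t by move=> St; apply: ge_inf => //; case: infS.
have atau : a <= tau by apply: lb_le_inf; [exists b|move=> t [/andP[]]].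
have taub : tau <= b by exact: tau_le.
have Ptau : P tau.
  move=> h h0; have h2 : 0 < h / 2 by rewrite divr_gt0.
  have [c c0 cu] := abs_continuous_near a b u tau acu
    ltac:(by rewrite atau taub) _ h2.
  have [t [abt Pt] ttau] := inf_adherent c0 infS.
  have taut : tau <= t by exact: tau_le.
  have [w wU uw] := Pt _ h2.
  exists w; first exact: covered_variation_le wU.
  have : `|u t - u tau| < h / 2.
    by apply: cu => //; rewrite ger0_norm ?subr_ge0// ltrBlDl.
  have : e * (b - t) <= e * (b - tau) by rewrite ler_pM2l// lerB.
  rewrite ltr_norml => ? /andP[_ ?]; lra.
move: atau; rewrite le_eqVlt => /predU1P[ataueq|atau].
  by move: Ptau; rewrite -ataueq.
exfalso.
suff [t tt St] : exists2 t, t < tau & S t.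
  by have := tau_le _ St; rewrite leNgt tt.
have step t : a <= t -> t < tau ->
    (forall w, covered_variation U u tau b w -> exists2 w',
      covered_variation U u t b w' & w + (u tau - u t) <= e * (tau - t) + w') ->
    S t.
  move=> at_ ttau tw; split; first by rewrite at_ (le_trans (ltW ttau)).
  move=> h h0; have [w /tw[w' w'U ww'] uw] := Ptau _ h0.
  by exists w' => //; lra.
(* In [U], the increment over a short interval to the left of [tau] joins the covered variation;
   outside [U], the slope bound at [tau] pays for the step. *)
have [Etau|nEtau] := pselect (U tau).
- move: oU; rewrite openE => /(_ _ Etau); rewrite /interior /=.
  move=> /nbhs_ballP[c /= c0 cU].
  exists (Num.max a (tau - c / 2)).
    by rewrite gt_max atau ltrBlDr ltrDl divr_gt0.
  apply: step; first by rewrite le_max lexx.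
    by rewrite gt_max atau ltrBlDr ltrDl divr_gt0.
  move=> w wU; exists (w + `|u tau - u (Num.max a (tau - c / 2))|).
    apply: covered_variation_cons => //.
      by rewrite ge_max (ltW atau) lerBlDr lerDl ltW// divr_gt0.
    move=> x; rewrite /= in_itv /= gt_max => /andP[/andP[_ tx] xt]; apply: cU.
    rewrite /ball /= ger0_norm ?subr_ge0 ?ltW//; lra.
  have : Num.max a (tau - c / 2) <= tau.
    by rewrite ge_max (ltW atau) lerBlDr lerDl ltW// divr_gt0.
  set y := Num.max _ _ => ytau.
  have : 0 <= e * (tau - y) by rewrite mulr_ge0 ?subr_ge0// ltW.
  have := ler_norm (u tau - u y); lra.
- have /(_ atau taub e e_gt0) [c c0 cu] : a < tau -> tau <= b ->
      left_slope_le u tau 0.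
    by apply: contrapT => h; apply: nEtau; apply: EU.
  have lty : Num.max a (tau - c / 2) < tau.
    by rewrite gt_max atau ltrBlDr ltrDl divr_gt0.
  exists (Num.max a (tau - c / 2)) => //.
  apply: step => //; first by rewrite le_max lexx.
  move=> w wU; exists w; first exact: covered_variation_le (ltW lty) wU.
  have := cu (Num.max a (tau - c / 2)) _ (ltW lty).
  rewrite add0r [w + _]addrC lerD2r; apply.
  by rewrite lt_max; apply/orP; right; lra.
Qed.

Lemma abs_continuous_dom {V : normedModType R} (a b : R) (X : R -> V)
    (u : R -> R) (K : R) : 0 <= K -> abs_continuous a b X ->
  (forall s t, a <= s -> s <= t -> t <= b ->
    `|u t - u s| <= K * (`|X t - X s| + (t - s))) ->
  abs_continuous a b u.
Proof.
move=> K0 acX uX e e0.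
have K1 : 0 < K + 1 by rewrite ltr_wpDl.
pose e' := e / (K + 1) / 2.
have e'0 : 0 < e' by rewrite !divr_gt0.
have [d d0 dX] := acX e' e'0.
exists (Num.min d e'); first by rewrite lt_min d0.
move=> n s t st triv; rewrite lt_min => /andP[std ste].
apply: (@le_lt_trans _ _ (\sum_(i < n)
  (K + 1) * (`|X (t i) - X (s i)| + (t i - s i)))).
  apply: ler_sum => i _; have [a_s s_t tb] := st i.
  apply: (le_trans (uX _ _ a_s s_t tb)); apply: ler_wpM2r; last by rewrite lerDl.
  by rewrite addr_ge0// subr_ge0.
rewrite -mulr_sumr big_split /= -ltr_pdivlMl// mulrC (splitr (e / _)).
by rewrite ltrD// dX.
Qed.

(** The monotone case applied to [u t - c * t]; it serves in place of integrating a derivative. *)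
Lemma abs_continuous_rate (a b c : R) (u : R -> R) : a <= b ->
  abs_continuous a b u ->
  {ae (@lebesgue_measure R),
    forall t, a < t -> t <= b -> left_slope_le u t c} ->
  u b - u a <= c * (b - a).
Proof.
move=> ab acu aeu.
suff : u b - c * b <= u a - c * a by lra.
apply: (@abs_continuous_nonincr a b (fun t => u t - c * t)) => //.
  apply: (abs_continuous_dom a b u _ (1 + `|c|)) => //.
  move=> s t _ st _.
  have -> : u t - c * t - (u s - c * s) = (u t - u s) - c * (t - s) by ring.
  rewrite (le_trans (ler_normB _ _))// normrM (ger0_norm (x := t - s)) ?subr_ge0//.
  rewrite mulrDl mul1r mulrDr -addrA lerD2l.
  have : 0 <= `|c| * `|u t - u s| by rewrite mulr_ge0.
  have : 0 <= t - s by rewrite subr_ge0.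
  lra.
apply: ae_impl aeu => t slope at_ tb e e0.
have [d d0 dslope] := slope at_ tb e e0; exists d => // s ts st.
by have := dslope s ts st; lra.
Qed.

End Abs_continuous.

(** * Matrix norms and limits, Lipschitz bounds on balls, Krasowskii hulls *)

Section Matrix_analysis.
Context {R : realType}.

Lemma norm_entry_le m n (A : 'M[R]_(m, n)) i j : `|A i j| <= `|A|.
Proof.
rewrite {2}/Num.norm /= mx_normrE.
exact: (le_bigmax _ (fun ij : 'I_m * 'I_n => `|A ij.1 ij.2|) (i, j)).
Qed.

Lemma mx_norm_le m n (A : 'M[R]_(m, n)) (c : R) : 0 <= c ->
  (forall i j, `|A i j| <= c) -> `|A| <= c.
Proof.
move=> c0 Ac; rewrite /Num.norm /= mx_normrE.
by apply/bigmax_leP; split=> // ij _.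
Qed.

Lemma norm_mulmx_le m n p (A : 'M[R]_(m, n)) (B : 'M[R]_(n, p)) :
  `|A *m B| <= n%:R * `|A| * `|B|.
Proof.
apply: mx_norm_le => [|i j]; first by rewrite !mulr_ge0.
rewrite mxE (le_trans (ler_norm_sum _ _ _))//.
apply: (@le_trans _ _ (\sum_(k < n) `|A| * `|B|)).
  by apply: ler_sum => k _; rewrite normrM ler_pM// norm_entry_le.
by rewrite sumr_const card_ord -mulrA mulr_natl.
Qed.

Lemma cvg_mx {T} {F : set_system T} {FF : Filter F} m n
    (M : T -> 'M[R]_(m, n)) (l : 'M[R]_(m, n)) :
  (forall i j, M t i j @[t --> F] --> l i j) -> M t @[t --> F] --> l.
Proof.
move=> Ml; apply/cvgrPdist_le => e e0.
have : \forall t \near F, forall ij : 'I_m * 'I_n,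
    `|l ij.1 ij.2 - M t ij.1 ij.2| <= e.
  apply: filter_forall => ij.
  by move/cvgrPdist_le : (Ml ij.1 ij.2) => /(_ e e0).
apply: filterS => t Mt; apply: mx_norm_le => [|i j]; first exact: ltW.
by rewrite !mxE; exact: (Mt (i, j)).
Qed.

Lemma cvg_entry {T} {F : set_system T} {FF : Filter F} m n
    (M : T -> 'M[R]_(m, n)) (l : 'M[R]_(m, n)) i j :
  M t @[t --> F] --> l -> M t i j @[t --> F] --> l i j.
Proof. move=> Ml; exact: (cvg_comp _ _ Ml (@coord_continuous R m n i j l)). Qed.

Lemma cvg_bigsum {T} {F : set_system T} {FF : Filter F} (I : Type) (r : seq I)
    (f : I -> T -> R) (l : I -> R) :
  (forall i, f i t @[t --> F] --> l i) ->
  \sum_(i <- r) f i t @[t --> F] --> \sum_(i <- r) l i.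
Proof.
move=> fl; elim: r => [|i r IH].
  by rewrite big_nil; under eq_fun do rewrite big_nil; exact: cvg_cst.
by rewrite big_cons; under eq_fun do rewrite big_cons; exact: cvgD.
Qed.

Lemma cvg_mulmx {T} {F : set_system T} {FF : Filter F} m n p
    (A : T -> 'M[R]_(m, n)) (B : T -> 'M[R]_(n, p))
    (a : 'M[R]_(m, n)) (b : 'M[R]_(n, p)) :
  A t @[t --> F] --> a -> B t @[t --> F] --> b ->
  A t *m B t @[t --> F] --> a *m b.
Proof.
move=> Aa Bb; apply: cvg_mx => i j; rewrite mxE; under eq_fun do rewrite mxE.
by apply: cvg_bigsum => k; apply: cvgM; exact: cvg_entry.
Qed.

Lemma cvg_trmx {T} {F : set_system T} {FF : Filter F} m n
    (A : T -> 'M[R]_(m, n)) (a : 'M[R]_(m, n)) :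
  A t @[t --> F] --> a -> (A t)^T @[t --> F] --> a^T.
Proof.
move=> Aa; apply: cvg_mx => i j; rewrite mxE; under eq_fun do rewrite mxE.
exact: cvg_entry.
Qed.

Lemma continuous_fst (V1 V2 : topologicalType) : continuous (@fst V1 V2).
Proof. by move=> X; exact: cvg_fst. Qed.

Lemma continuous_snd (V1 V2 : topologicalType) : continuous (@snd V1 V2).
Proof. by move=> X; exact: cvg_snd. Qed.

Lemma continuous_compose (T U T' : topologicalType) (p : T -> U) (q : U -> T') :
  continuous p -> continuous q -> continuous (fun t => q (p t)).
Proof. by move=> cp cq t; apply: continuous_comp; [exact: cp|exact: cq]. Qed.

Lemma continuous_bigsum {T : topologicalType} (I : Type) (r : seq I)
    (f : I -> T -> R) :
  (forall i, continuous (f i)) -> continuous (fun t => \sum_(i <- r) f i t).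
Proof. by move=> cf t; apply: cvg_bigsum => i; exact: cf. Qed.

Lemma continuous_mulmx {T : topologicalType} m n p
    (A : T -> 'M[R]_(m, n)) (B : T -> 'M[R]_(n, p)) :
  continuous A -> continuous B -> continuous (fun t => A t *m B t).
Proof. by move=> cA cB t; apply: cvg_mulmx; [exact: cA|exact: cB]. Qed.

Lemma continuous_trmx {T : topologicalType} m n (A : T -> 'M[R]_(m, n)) :
  continuous A -> continuous (fun t => (A t)^T).
Proof. by move=> cA t; apply: cvg_trmx; exact: cA. Qed.

Lemma continuous_entry {T : topologicalType} m n (A : T -> 'M[R]_(m, n)) i j :
  continuous A -> continuous (fun t => A t i j).
Proof. by move=> cA t; apply: cvg_entry; exact: cA. Qed.

Lemma continuous_mx {T : topologicalType} m n (A : T -> 'M[R]_(m, n)) :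
  (forall i j, continuous (fun t => A t i j)) -> continuous A.
Proof. by move=> cA t; apply: cvg_mx => i j; exact: cA. Qed.

Lemma norm_trmx_le m n (A : 'M[R]_(m, n)) : `|A^T| <= `|A|.
Proof. by apply: mx_norm_le => // i j; rewrite mxE norm_entry_le. Qed.

Lemma row_delta_mul n (i : 'I_n) (w : 'cV[R]_n) :
  (delta_mx ord0 i *m w : 'cV[R]_1) ord0 ord0 = w i ord0.
Proof. by rewrite -rowE mxE. Qed.

Lemma row_opp_mul n (r : 'rV[R]_n) (w : 'cV[R]_n) :
  (- r *m w) ord0 ord0 = - (r *m w) ord0 ord0.
Proof. by rewrite mulNmx mxE. Qed.

Lemma norm_delta_le m n (i : 'I_m) (j : 'I_n) :
  `|delta_mx i j : 'M[R]_(m, n)| <= 1.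
Proof.
apply: mx_norm_le => // k l; rewrite mxE.
by case: (_ && _); rewrite ?normr1 ?normr0.
Qed.

(** Rows come with their opposites, so one-sided estimates already give equality. *)
Lemma eq_from_rows n (u w : 'cV[R]_n) :
  (forall r : 'rV[R]_n, (r *m u) ord0 ord0 <= (r *m w) ord0 ord0) -> u = w.
Proof.
move=> uw; apply/colP => i; apply/eqP; rewrite eq_le.
have := uw (delta_mx ord0 i); have := uw (- delta_mx ord0 i).
by rewrite !row_opp_mul !row_delta_mul lerN2 => -> ->.
Qed.

Lemma norm_le_from_rows n (w : 'cV[R]_n) (C : R) : 0 <= C ->
  (forall r : 'rV[R]_n, `|r| <= 1 -> (r *m w) ord0 ord0 <= C) -> `|w| <= C.
Proof.
move=> C0 wC; apply: mx_norm_le => // i j; rewrite ord1 ler_norml lerNl.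
have := wC (delta_mx ord0 i); have := wC (- delta_mx ord0 i).
rewrite normrN row_opp_mul row_delta_mul.
by move=> /(_ (norm_delta_le _ _ _ _)) -> /(_ (norm_delta_le _ _ _ _)) ->.
Qed.

Lemma compact_closed_ball_col n (r : R) : compact [set a : 'cV[R]_n | `|a| <= r].
Proof.
have -> : [set a : 'cV[R]_n | `|a| <= r] = trmx @` [set a : 'rV[R]_n | `|a| <= r].
  apply/seteqP; split=> a /=.
    move=> ar; exists a^T; last by rewrite trmxK.
    exact: le_trans (norm_trmx_le _ _ _) ar.
  by move=> [b br <-]; exact: le_trans (norm_trmx_le _ _ _) br.
apply: continuous_compact.
  apply: continuous_subspaceT => a.
  exact: (@cvg_trmx _ _ (nbhs_filter a) _ _ id a cvg_id).
apply: bounded_closed_compact.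
  exists r; split; first exact: num_real.
  by move=> x rx a /= /le_trans; apply; exact: ltW.
apply: (@preimage_closed _ _ (fun a : 'rV[R]_n => `|a|) [set x | x <= r]).
  by move=> a _; exact: norm_continuous.
exact: closed_le.
Qed.

Lemma continuous_bounded_ball n (V : normedModType R) (Psi : 'cV[R]_n -> V) r :
  continuous Psi -> exists2 C, 0 <= C & forall a, `|a| <= r -> `|Psi a| <= C.
Proof.
move=> cPsi; have [C [_ CP]] := compact_bounded (continuous_compact
  (continuous_subspaceT cPsi) (compact_closed_ball_col n r)).
exists (`|C| + 1); first by rewrite addr_ge0.
move=> a ar; apply: (CP (`|C| + 1)).
  by rewrite (le_lt_trans (ler_norm C))// ltrDl.
by exists a.
Qed.

(** A continuous function attains its minimum on the compact shell, which avoids 0; an empty shell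
    is treated apart. *)
Lemma positive_definite_shell n (W : 'cV[R]_n -> R) (e r : R) : 0 < e ->
  continuous W -> (forall a, a != 0 -> 0 < W a) ->
  exists2 w, 0 < w & forall a, e <= `|a| -> `|a| <= r -> w <= W a.
Proof.
move=> e0 cW W0.
pose K := [set a : 'cV[R]_n | `|a| <= r] `&` [set a | e <= `|a|].
have [K0|/set0P Kn] := eqVneq K set0.
  by exists 1 => // a ea ar; have : K a by []; rewrite K0.
have cK : compact K.
  apply: (subclosed_compact _ (compact_closed_ball_col n r)).
    apply: closedI; first exact: compact_closed (compact_closed_ball_col n r).
    apply: (@preimage_closed _ _ (fun a : 'cV[R]_n => `|a|) [set x | e <= x]).
      by move=> a _; exact: norm_continuous.
    exact: closed_ge.
  by move=> a [].
have [c Kc cmin] := compact_EVT_min Kn cK (continuous_subspaceT cW).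
move: Kc; rewrite inE => -[_ ec]; exists (W c).
  by apply: W0; rewrite -normr_gt0 (lt_le_trans e0).
by move=> a ea ar; apply: cmin; rewrite inE.
Qed.

(** The constant may grow with the radius. This suffices for absolute continuity along a solution,
    which is bounded on compact intervals. *)
Definition ball_lipschitz {V : normedModType R} (Psi : V -> R) : Prop :=
  forall rho, exists2 K, 0 <= K & forall z s, `|z| <= rho -> `|s| <= rho ->
    `|Psi s - Psi z| <= K * `|s - z|.

Lemma ball_lipschitz_comp {V1 V2 : normedModType R} (L : V1 -> V2)
    (Psi : V2 -> R) (k : R) : 0 <= k -> L 0 = 0 ->
  (forall u w, `|L u - L w| <= k * `|u - w|) ->
  ball_lipschitz Psi -> ball_lipschitz (Psi \o L).
Proof.
move=> k0 L0 lipL lipPsi rho.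
have [K K0 lipK] := lipPsi (k * rho).
exists (K * k); first exact: mulr_ge0.
have Lrho u : `|u| <= rho -> `|L u| <= k * rho.
  move=> urho; have := lipL u 0; rewrite L0 !subr0 => /le_trans; apply.
  exact: ler_wpM2l.
move=> z s /Lrho zr /Lrho sr; apply: le_trans (lipK _ _ zr sr) _.
by rewrite -mulrA ler_wpM2l.
Qed.

Lemma ball_lipschitz_add {V : normedModType R} (Phi Psi : V -> R) :
  ball_lipschitz Phi -> ball_lipschitz Psi ->
  ball_lipschitz (fun a => Phi a + Psi a).
Proof.
move=> lipPhi lipPsi rho.
have [K K0 lipK] := lipPhi rho; have [L L0 lipL] := lipPsi rho.
exists (K + L) => [|z s zr sr]; first exact: addr_ge0.
rewrite opprD addrACA (le_trans (ler_normD _ _))// mulrDl.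
by rewrite lerD ?lipK ?lipL.
Qed.

Lemma ball_lipschitz_row n (r : 'rV[R]_n) :
  ball_lipschitz (fun a : 'cV[R]_n => (r *m a) ord0 ord0).
Proof.
move=> rho; exists (n%:R * `|r|) => [|z s _ _]; first by rewrite mulr_ge0.
apply: le_trans (norm_mulmx_le _ _ _ _ _); rewrite mulmxBr.
by have := norm_entry_le _ _ (r *m s - r *m z) ord0 ord0; rewrite !mxE.
Qed.

Lemma norm_fst_le {V1 V2 : normedModType R} (u : V1 * V2) : `|u.1| <= `|u|.
Proof. by rewrite prod_normE le_max lexx. Qed.

Lemma norm_snd_le {V1 V2 : normedModType R} (u : V1 * V2) : `|u.2| <= `|u|.
Proof. by rewrite prod_normE le_max lexx orbT. Qed.

Lemma abs_continuous_bounded (V : normedModType R) (a b : R) (X : R -> V) :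
  a <= b -> abs_continuous a b X ->
  exists rho, forall t, a <= t -> t <= b -> `|X t| <= rho.
Proof.
move=> ab acX.
(* Precomposing with the 1-Lipschitz projection onto [[a, b]] makes [X] continuous on the whole
   line, so compactness of the segment applies. *)
pose clamp (t : R) := Num.max a (Num.min b t).
have clamp_in t : a <= clamp t <= b.
  by rewrite /clamp le_max lexx ge_max ab ge_min lexx.
have clamp_lip s t : `|clamp s - clamp t| <= `|s - t|.
  rewrite /clamp; case: (leP b s) => ?; case: (leP b t) => ?;
    case: (leP a) => ?; try (case: (leP a) => ?);
    rewrite ler_norml; case: (ger0P (s - t)) => ?; apply/andP; split; lra.
have cX : continuous (X \o clamp).
  move=> t; apply/cvgrPdist_lt => e e0.
  have [d d0 Xd] := abs_continuous_near _ _ X _ acX (clamp_in t) e e0.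
  apply/nbhs_ballP; exists d => // s; rewrite /ball /= => ts.
  rewrite distrC; apply: Xd (clamp_in s) _.
  by rewrite (le_lt_trans (clamp_lip _ _))// distrC.
have [C [_ CX]] := compact_bounded
  (continuous_compact (continuous_subspaceT cX) (@segment_compact _ a b)).
exists (C + 1) => t at_ tb; apply: (CX (C + 1)); first by rewrite ltrDl.
exists t; first by rewrite /= in_itv /= at_.
by rewrite /= /clamp (min_r tb) (max_r at_).
Qed.

Lemma continuous_small_at0 (V1 V2 : normedModType R) (Psi : V1 -> V2) e :
  continuous Psi -> Psi 0 = 0 -> 0 < e ->
  exists2 d, 0 < d & forall y, `|y| < d -> `|Psi y| <= e.
Proof.
move=> cPsi Psi0 e0; have /cvgrPdist_le /(_ _ e0) := cPsi 0.
move=> /nbhs_normP[d /= d0 Psid]; exists d => // y yd.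
have := Psid y; rewrite /ball_ /= sub0r normrN => /(_ yd).
by rewrite Psi0 sub0r normrN.
Qed.

Lemma ball_lipschitz_continuous (V : normedModType R) (Psi : V -> R) :
  ball_lipschitz Psi -> continuous Psi.
Proof.
move=> lip z; apply/cvgrPdist_le => e e0.
have [K K0 lipK] := lip (`|z| + 1).
have K1 : 0 < K + 1 by rewrite ltr_wpDl.
apply/nbhs_normP; exists (Num.min 1 (e / (K + 1))).
  by rewrite /= lt_min ltr01 divr_gt0.
move=> s /=; rewrite /ball_ lt_min => /andP[zs1 zse].
have zr : `|z| <= `|z| + 1 by rewrite lerDl.
have sr : `|s| <= `|z| + 1.
  rewrite -[s](subrK z) (le_trans (ler_normD _ _))// addrC lerD2l.
  by rewrite distrC ltW.
apply: (le_trans (lipK _ _ sr zr)).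
move: zse; rewrite ltr_pdivlMr// => /ltW; apply: le_trans.
by rewrite mulrC ler_wpM2l// lerDl.
Qed.

Lemma derivable_approx (V : normedModType R) (y : R -> V) t :
  derivable y t 1 -> forall e, 0 < e -> exists2 d, 0 < d & forall s,
    `|s - t| < d -> `|y s - y t - (s - t) *: derive1 y t| <= e * `|s - t|.
Proof.
move=> dy e e0; move/cvgrPdist_le: (dy) => /(_ e e0).
rewrite -/(derive y t 1) -derive1E => /nbhs_ballP[d /= d0 dyd].
exists d => // s; have [-> _|st std] := eqVneq s t.
  by rewrite !subrr scale0r subrr !normr0 mulr0.
have h0 : s - t != 0 by rewrite subr_eq0.
have := dyd (s - t); rewrite /ball /= sub0r normrN => /(_ std h0).
rewrite [(s - t)%:A]mulr1 subrK distrC => dle.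
have -> : y s - y t - (s - t) *: derive1 y t =
    (s - t) *: ((s - t)^-1 *: (y s - y t) - derive1 y t).
  by rewrite scalerBr scalerA divff// scale1r.
by rewrite normrZ mulrC ler_wpM2r.
Qed.

Lemma derive1_pair (V1 V2 : normedModType R) (x : R -> V1) (y : R -> V2) t :
  derivable (fun s => (x s, y s)) t 1 ->
  [/\ derivable x t 1, derivable y t 1
    & derive1 (fun s => (x s, y s)) t = (derive1 x t, derive1 y t)].
Proof.
move=> /cvg_ex[[l1 l2] dxy].
have dx : h^-1 *: ((x \o shift t) (h *: 1) - x t) @[h --> 0^'] --> l1.
  exact: (cvg_comp _ _ dxy cvg_fst).
have dy : h^-1 *: ((y \o shift t) (h *: 1) - y t) @[h --> 0^'] --> l2.
  exact: (cvg_comp _ _ dxy cvg_snd).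
split; [by apply/cvg_ex; exists l1|by apply/cvg_ex; exists l2|].
by rewrite !derive1E /derive (cvg_lim _ dxy)// (cvg_lim _ dx)// (cvg_lim _ dy).
Qed.

(** For each [e > 0] the half-space [l <= Phi X + e] is closed and convex and contains the image
    under [F] of a small ball, hence also its closed convex hull. *)
Lemma krasowskii_le (V : normedModType R) (F : V -> V) (X y : V)
    (l Phi : V -> R) :
  continuous l -> (forall (k : R) a b, l (k *: a + b) = k * l a + l b) ->
  (forall Y, l (F Y) <= Phi Y) -> {for X, continuous Phi} ->
  krasowskii F X y -> l y <= Phi X.
Proof.
move=> cl linl lF cPhi Ky; apply/ler_addgt0Pr => e e0.
have /nbhs_ballP[d /= d0 dPhi] : \forall Y \near X, Phi Y <= Phi X + e.
  move/cvgrPdist_le: cPhi => /(_ e e0); apply: filterS => Y.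
  by rewrite ler_norml => /andP[]; lra.
have := Ky d d0; apply: (smallest_sub (X := [set a | l a <= Phi X + e])).
  split.
    apply: (@preimage_closed _ _ l [set x | x <= Phi X + e]).
      by move=> a _; exact: cl.
    exact: closed_le.
  move=> a b k; rewrite !inE /= => la lb.
  have l0 : l 0 = 0.
    by have := linl 1 0 0; rewrite scaler0 addr0 mul1r; lra.
  have -> : l (conv k a b) = k%:num * l a + (1 - k%:num) * l b.
    rewrite /conv /= linl; congr (_ + _).
    by rewrite -[X in l X]addr0 linl l0 addr0.
  have k0 : 0 <= k%:num by [].
  have k1 : 0 <= 1 - k%:num by rewrite subr_ge0.
  have := ler_wpM2l k0 la; have := ler_wpM2l k1 lb; lra.
by move=> _ [Y XY <-] /=; apply: le_trans (lF Y) (dPhi _ XY).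
Qed.

End Matrix_analysis.

(** * The convex potential of the quantizer *)

Section Quantizer_potential.
Context {R : realType}.
Variable Delta : R.
Hypothesis Delta_gt0 : 0 < Delta.

(* The primitive of the quantizer vanishing at 0 is the upper envelope over    *)
(* the integers k of the lines r |-> Delta * k * r - Delta^2 * k^2 / 2.        *)
Definition quantizer_primitive (r : R) : R :=
  let k := (Num.floor (r / Delta + 1 / 2))%:~R in
  Delta * k * r - Delta ^+ 2 * k ^+ 2 / 2.

(** With [t = r / Delta] and [m] the integer nearest to [t], the gap is
    [Delta^2 (m - k) (t - (m + k) / 2)], and the last two factors never have opposite signs because
    [m] and [k] are integers. *)
Lemma quantizer_primitive_ge (k : int) (r : R) :
  Delta * k%:~R * r - Delta ^+ 2 * k%:~R ^+ 2 / 2 <= quantizer_primitive r.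
Proof.
rewrite /quantizer_primitive; set m := Num.floor _.
have := floor_itv (r / Delta + 1 / 2); rewrite -/m intrD => /andP[].
set t := r / Delta; have -> : r = Delta * t by rewrite mulrC divfK ?gt_eqF.
move=> mt tm; rewrite -subr_ge0.
have -> : Delta * m%:~R * (Delta * t) - Delta ^+ 2 * m%:~R ^+ 2 / 2 -
  (Delta * k%:~R * (Delta * t) - Delta ^+ 2 * k%:~R ^+ 2 / 2) =
  Delta ^+ 2 * ((m%:~R - k%:~R) * (t - (m%:~R + k%:~R) / 2)) by field.
apply: mulr_ge0; first by rewrite exprn_ge0// ltW.
have [mk|km|->] := ltgtP m k; last by rewrite subrr mul0r.
- have : (m + 1)%:~R <= k%:~R :> R by rewrite ler_int lezD1.
  rewrite intrD => mk'.
  by apply: mulr_le0; rewrite subr_le0; lra.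
- have : (k + 1)%:~R <= m%:~R :> R by rewrite ler_int lezD1.
  rewrite intrD => km'.
  by apply: mulr_ge0; rewrite subr_ge0; lra.
Qed.

Lemma quantizer_primitive_ge0 r : 0 <= quantizer_primitive r.
Proof.
by have := quantizer_primitive_ge 0 r; rewrite expr0n /= !mulr0 !mul0r subrr.
Qed.

Lemma quantizer_primitive0 : quantizer_primitive 0 = 0.
Proof.
apply/eqP; rewrite eq_le quantizer_primitive_ge0 andbT /quantizer_primitive.
by rewrite mulr0 sub0r oppr_le0 -exprMn divr_ge0// sqr_ge0.
Qed.

Lemma quantizer_primitive_norm r :
  Delta * (`|r| - Delta / 2) <= quantizer_primitive r.
Proof.
have h1 := quantizer_primitive_ge 1 r; have h2 := quantizer_primitive_ge (-1) r.
move: h1 h2; rewrite intrN !mulr1 expr1n mulrN1 sqrrN expr1n !mulr1.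
by have [r0|r0] := ger0P r; move: (quantizer_primitive r) => q; lra.
Qed.

(** The line active at [r] has slope [quantizer Delta r] and lies below the envelope at [s]. *)
Lemma quantizer_primitive_subgradient r s :
  quantizer_primitive r + quantizer Delta r * (s - r) <= quantizer_primitive s.
Proof.
apply: le_trans (quantizer_primitive_ge (Num.floor (r / Delta + 1 / 2)) s).
by rewrite {1}/quantizer_primitive /quantizer; set m := _%:~R; lra.
Qed.

Lemma quantizer_norm r : `|quantizer Delta r| <= `|r| + Delta / 2.
Proof.
rewrite /quantizer; set m := Num.floor _.
have := floor_itv (r / Delta + 1 / 2); rewrite -/m intrD => /andP[].
set t := r / Delta; have -> : r = Delta * t by rewrite mulrC divfK ?gt_eqF.
move=> mt tm; rewrite (normrM _ m%:~R) (normrM _ t) (gtr0_norm Delta_gt0).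
rewrite -mulrDr ler_pM2l//.
rewrite ler_norml; have [t0|t0] := ger0P t; apply/andP; split; lra.
Qed.

(** The subgradient inequality in both directions, with slopes bounded by [quantizer_norm]. *)
Lemma quantizer_primitive_lipschitz rho r s : `|r| <= rho -> `|s| <= rho ->
  `|quantizer_primitive s - quantizer_primitive r| <=
    (rho + Delta / 2) * `|s - r|.
Proof.
have half r' s' : `|r'| <= rho -> quantizer_primitive r' -
    quantizer_primitive s' <= (rho + Delta / 2) * `|s' - r'|.
  move=> r'rho; have := quantizer_primitive_subgradient r' s'.
  have : - (quantizer Delta r' * (s' - r')) <= (rho + Delta / 2) * `|s' - r'|.
    apply: (le_trans (ler_norm _)); rewrite normrN normrM ler_wpM2r//.
    by rewrite (le_trans (quantizer_norm _))// lerD2r.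
  lra.
move=> /(half r s) h1 /(half s r) h2.
by rewrite ler_norml; move: h2; rewrite distrC; lra.
Qed.

Context {c : nat}.
Implicit Types z s : 'cV[R]_c.

Definition potential z : R := \sum_(j < c) quantizer_primitive (z j ord0).

Lemma potential_ge0 z : 0 <= potential z.
Proof. by apply: sumr_ge0 => j _; exact: quantizer_primitive_ge0. Qed.

Lemma potential0 : potential 0 = 0.
Proof. by rewrite /potential big1 // => j _; rewrite mxE quantizer_primitive0. Qed.

Lemma potential_norm z : Delta * (`|z| - Delta / 2) <= potential z.
Proof.
suff : `|z| <= potential z / Delta + Delta / 2.
  by rewrite -lerBlDr ler_pdivlMr// mulrC.
apply: mx_norm_le => [|i j].
  by rewrite addr_ge0 ?divr_ge0 ?potential_ge0 ?ltW.
rewrite -lerBlDr ler_pdivlMr// mulrC ord1.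
apply: le_trans (quantizer_primitive_norm _) _.
rewrite /potential (bigD1 i)//= lerDl; apply: sumr_ge0 => k _.
exact: quantizer_primitive_ge0.
Qed.

Lemma potential_subgradient z s :
  potential z + ((map_mx (quantizer Delta) z)^T *m (s - z)) ord0 ord0
    <= potential s.
Proof.
rewrite mxE -big_split /=; apply: ler_sum => j _.
by rewrite !mxE; exact: quantizer_primitive_subgradient.
Qed.

Lemma potential_lipschitz : ball_lipschitz potential.
Proof.
move=> rho; exists (c%:R * (`|rho| + Delta / 2)).
  by rewrite mulr_ge0// addr_ge0// divr_ge0// ltW.
move=> z s zr sr; rewrite /potential -sumrB (le_trans (ler_norm_sum _ _ _))//.
rewrite -mulrA mulr_natl -[X in _ *+ X]card_ord -sumr_const.
apply: ler_sum => j _.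
apply: (@le_trans _ _ ((`|rho| + Delta / 2) * `|s j ord0 - z j ord0|)).
  apply: quantizer_primitive_lipschitz.
    exact: le_trans (norm_entry_le _ _ _ _ _) (le_trans zr (ler_norm _)).
  exact: le_trans (norm_entry_le _ _ _ _ _) (le_trans sr (ler_norm _)).
rewrite ler_wpM2l//; first by rewrite addr_ge0// divr_ge0// ltW.
by have := norm_entry_le _ _ (s - z) j ord0; rewrite !mxE.
Qed.

End Quantizer_potential.

(** * Chain rules and slopes of composite functions *)

Section Differentiation.
Context {R : realType}.

Lemma diff_grad n (S : 'cV[R]_n -> R) a w : differentiable S a ->
  'd S a w = (grad S a *m w) ord0 ord0.
Proof.
move=> dS; rewrite {1}[w]matrix_sum_delta linear_sum mxE.
apply: eq_bigr => j _; rewrite big_ord1 linearZ /= mxE deriveE//.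
by rewrite mulrC.
Qed.

Lemma derive1_comp_grad n (S : 'cV[R]_n -> R) (y : R -> 'cV[R]_n) t :
  differentiable S (y t) -> derivable y t 1 ->
  derivable (S \o y) t 1 /\
  derive1 (S \o y) t = (grad S (y t) *m derive1 y t) ord0 ord0.
Proof.
move=> dS /derivable1_diffP dy.
have dSy : differentiable (S \o y) t by exact: differentiable_comp.
split; first exact/derivable1_diffP.
by rewrite !derive1E' // diff_comp//= diff_grad.
Qed.

Lemma derive1_mulmx m n (A : 'M[R]_(m, n)) (y : R -> 'cV[R]_n) t :
  derivable y t 1 -> derivable (fun s => A *m y s) t 1 /\
  derive1 (fun s => A *m y s) t = A *m derive1 y t.
Proof.
move=> dy.
have dAy : h^-1 *: (A *m y (h *: 1 + t) - A *m y t) @[h --> 0^'] -->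
    A *m 'D_1 y t.
  under eq_fun do rewrite -mulmxBr scalemxAr.
  by apply: cvg_mulmx; [exact: cvg_cst|exact: dy].
split; first by apply/cvg_ex; eexists; exact: dAy.
by rewrite !derive1E; apply: cvg_lim dAy.
Qed.

Lemma left_slope_le_derive (u : R -> R) t c : derivable u t 1 ->
  derive1 u t <= c -> left_slope_le u t c.
Proof.
move=> du uc e e0; have [d d0 dapp] := derivable_approx _ _ _ du _ e0.
exists d => // s tds st.
have ts0 : 0 <= t - s by rewrite subr_ge0.
have nts : `|s - t| = t - s by rewrite distrC ger0_norm.
have := dapp s; rewrite nts ltrBlDl -ltrBlDr => /(_ tds).
rewrite ler_norml /GRing.scale /= => /andP[lo _].
have := ler_wpM2r ts0 uc; lra.
Qed.

Lemma left_slope_le_row n (r : 'rV[R]_n) (y : R -> 'cV[R]_n) t c :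
  derivable y t 1 -> (r *m derive1 y t) ord0 ord0 <= c ->
  left_slope_le (fun s => (r *m y s) ord0 ord0) t c.
Proof.
move=> /(derive1_mulmx _ _ r)[dry dryE] rc.
apply: left_slope_le_derive.
  exact: (derivable_mxP (fun s => r *m y s) t 1).1 dry ord0 ord0.
rewrite derive1E; move: rc; rewrite -dryE derive1E derive_mx//.
by rewrite mxE.
Qed.

(** Take [tau = t - s]: then [z t - tau *: derive1 z t] differs from [z s] by [o(tau)], so, [P]
    being Lipschitz on balls, the quotient in the hypothesis cancels [P (z t) - P (z s)] up to
    [o(tau)]. No derivative of [P] occurs. *)
Lemma left_slope_le_add (V : normedModType R) (phi : R -> R) (z : R -> V)
    (P : V -> R) t c : derivable phi t 1 -> derivable z t 1 ->
  ball_lipschitz P ->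
  (forall tau, 0 < tau -> derive1 phi t <=
     c + (P (z t - tau *: derive1 z t) - P (z t)) / tau) ->
  left_slope_le (fun s => phi s + P (z s)) t c.
Proof.
move=> dphi dz lipP slope e e0.
(* For [tau <= 1] this ball contains both [z s] and its linear approximation; the extra 1 absorbs
   their distance. *)
have [K K0 lipK] := lipP (`|z t| + 1 + `|derive1 z t|).
have e2 : 0 < e / 2 by rewrite divr_gt0.
have K1 : 0 < K + 1 by rewrite ltr_wpDl.
pose e' := Num.min 1 (e / 2 / (K + 1)).
have e'0 : 0 < e' by rewrite lt_min ltr01 divr_gt0.
have [d1 d10 phiapp] := derivable_approx _ _ _ dphi _ e2.
have [d2 d20 zapp] := derivable_approx _ _ _ dz _ e'0.
exists (Num.min 1 (Num.min d1 d2)); first by rewrite !lt_min ltr01 d10.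
move=> s tds st.
have [->|/eqP stn] := eqVneq s t; first by rewrite !subrr mulr0.
have ts0 : 0 < t - s by rewrite subr_gt0 lt_neqAle st andbT; exact/eqP.
have nts : `|s - t| = t - s by rewrite distrC gtr0_norm.
have : t - s < Num.min 1 (Num.min d1 d2) by rewrite ltrBlDl -ltrBlDr.
rewrite !lt_min => /and3P[ts1 tsd1 tsd2].
have := phiapp s; rewrite nts => /(_ tsd1); rewrite ler_norml => /andP[philo _].
have := zapp s; rewrite nts => /(_ tsd2) zlo.
have zE : z s - (z t - (t - s) *: derive1 z t) =
    z s - z t - (s - t) *: derive1 z t.
  by rewrite opprB addrCA addrC -addrA -scaleNr opprB addrA.
have near1 : `|z t - (t - s) *: derive1 z t| <= `|z t| + `|derive1 z t|.
  rewrite (le_trans (ler_normB _ _))// lerD2l normrZ (gtr0_norm ts0).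
  by rewrite ler_piMl// ltW.
have lipz : P (z t - (t - s) *: derive1 z t) - P (z s) <= e / 2 * (t - s).
  apply: le_trans (ler_norm _) _; rewrite distrC.
  apply: (@le_trans _ _ (K * (e' * (t - s)))).
    apply: (@le_trans _ _ (K * `|z s - (z t - (t - s) *: derive1 z t)|)).
      apply: lipK; first by rewrite (le_trans near1)// lerD2r lerDl.
      rewrite -[z s](subrK (z t - (t - s) *: derive1 z t)).
      rewrite (le_trans (ler_normD _ _))// addrC -addrA [1 + _]addrC addrA.
      rewrite lerD// zE (le_trans zlo)//.
      apply: mulr_ile1; [exact: ltW|exact: ltW| |exact: ltW].
      by rewrite ge_min lexx.
    by rewrite ler_wpM2l// zE.
  rewrite mulrA ler_wpM2r ?(ltW ts0)//.
  apply: (@le_trans _ _ ((K + 1) * e')).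
    by rewrite ler_wpM2r ?lerDl// ltW.
  by rewrite mulrC -ler_pdivlMr// ge_min lexx orbT.
have := slope _ ts0; rewrite -lerBlDl ler_pdivlMr// => zslope.
rewrite /GRing.scale /= in philo.
lra.
Qed.

(** Mean value theorem along the segment from [a] to [b], which stays in the ball, where the
    gradient is bounded. *)
Lemma ball_lipschitz_C1 n (S : 'cV[R]_n -> R) :
  continuously_differentiable S -> ball_lipschitz S.
Proof.
move=> [dS cgrad] rho.
have [C C0 gradC] := continuous_bounded_ball n _ _ rho cgrad.
exists (n%:R * C); first by rewrite mulr_ge0.
move=> a b ar br.
pose y (s : R) := a + s *: (b - a).
have dy (s : R) : is_derive s (1 : R) y (b - a).
  have yE : (fun h : R => h^-1 *: ((y \o shift s) (h *: 1) - y s)) @ 0^' -->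
      b - a.
    apply: (@cvg_near_cst _ _ (b - a)).
    near=> h; have h0 : h != 0 by near: h; exact: nbhs_dnbhs_neq.
    rewrite /y /= [h%:A]mulr1 opprD addrACA subrr add0r -scalerBl addrK.
    by rewrite scalerA mulVf// scale1r.
  by split; [apply/cvg_ex; exists (b - a)|exact: cvg_lim yE].
have dSy (s : R) : is_derive s (1 : R) (S \o y)
    ((grad S (y s) *m (b - a)) ord0 ord0).
  have [dys vys] := dy s.
  have [dSys dE] := derive1_comp_grad _ S y s (dS _) dys.
  by split=> //; rewrite -derive1E dE derive1E vys.
have [c cab] := MVT_segment ler01 (fun s _ => dSy s)
  (derivable_within_continuous (fun s _ => (dSy s).(ex_derive))).
rewrite /y /= scale0r addr0 scale1r [a + (b - a)]addrC subrK subr0 mulr1 => ->.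
apply: le_trans (norm_entry_le _ _ _ _ _) _.
apply: le_trans (norm_mulmx_le _ _ _ _ _) _; rewrite ler_wpM2r// ler_wpM2l//.
apply: gradC; move: cab; rewrite in_itv /= => /andP[c0 c1].
have -> : a + c *: (b - a) = (1 - c) *: a + c *: b.
  by rewrite scalerBl scale1r scalerBr addrAC addrA.
rewrite (le_trans (ler_normD _ _))// !normrZ ger0_norm ?subr_ge0//.
rewrite (ger0_norm c0).
have := ler_wpM2l c0 br; have c1' : 0 <= 1 - c by rewrite subr_ge0.
have := ler_wpM2l c1' ar; lra.
Unshelve. all: by end_near. Qed.

End Differentiation.

(* A bound affine in u that holds for every u has equal linear parts. *)
Lemma dissipation_affine {R : realType} n m (G : 'rV[R]_n) (F : 'cV[R]_n)
    (K : 'M[R]_(n, m)) (H : 'cV[R]_m) (w : R) :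
  (forall u, (G *m (F + K *m u)) ord0 ord0 <= - w + (H^T *m u) ord0 ord0) ->
  (G *m F) ord0 ord0 <= - w /\ G *m K = H^T.
Proof.
move=> GFK; split.
  have := GFK 0; rewrite !mulmx0 addr0 [X in _ <= _ + X]mxE addr0.
  exact.
apply/eqP; rewrite -subr_eq0; set d := _ - _.
pose q := (d *m d^T) ord0 ord0.
have qE : q = \sum_j d ord0 j ^+ 2.
  by rewrite /q mxE; apply: eq_bigr => j _; rewrite [d^T _ _]mxE expr2.
have q0 : 0 <= q by rewrite qE sumr_ge0// => j _; exact: sqr_ge0.
(* Testing with [u = k *: d^T] bounds every multiple of the squared length [q] of [d], which forces
   [q = 0]. *)
have kq k : k * q <= - w - (G *m F) ord0 ord0.
  have := GFK (k *: d^T).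
  rewrite mulmxDr mulmxA -!scalemxAr [leLHS]mxE [X in _ + X <= _]mxE.
  rewrite [X in _ <= _ + X]mxE.
  have -> : q = (G *m K *m d^T) ord0 ord0 - (H^T *m d^T) ord0 ord0.
    by rewrite /q {1}/d mulmxBl [LHS]mxE [X in _ + X]mxE.
  by rewrite mulrBr; lra.
have q_eq0 : q = 0.
  apply/eqP; rewrite eq_le q0 andbT leNgt; apply/negP => q_gt0.
  have := kq ((- w - (G *m F) ord0 ord0 + 1) / q).
  by rewrite divfK ?gt_eqF//; lra.
move: q_eq0; rewrite qE => /psumr_eq0P d0.
apply/eqP/rowP => j; rewrite [RHS]mxE; apply/eqP; rewrite -sqrf_eq0.
by rewrite d0// => k _; exact: sqr_ge0.
Qed.

(** * The loop with an abstract matrix [B], and its Krasowskii inclusion *)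

Section Loop.
Context {R : realType} {a b c : nat}.
Variables (B : 'M[R]_(a, c)) (f : 'cV[R]_b -> 'cV[R]_b)
  (g : 'cV[R]_b -> 'M[R]_(b, a)) (h : 'cV[R]_b -> 'cV[R]_a)
  (v : R -> 'cV[R]_a) (Delta : R).

Definition quantized_loop (t : R) (X : 'cV[R]_a * 'cV[R]_b) :
    'cV[R]_a * 'cV[R]_b :=
  (h X.2 + v t, f X.2 - g X.2 *m B *m map_mx (quantizer Delta) (B^T *m X.1)).

Hypothesis Delta_gt0 : 0 < Delta.
Hypothesis Bv0 : forall t, B^T *m v t = 0.
Hypothesis cf : continuous f.
Hypothesis cg : continuous g.
Hypothesis ch : continuous h.
Hypothesis f0 : f 0 = 0.
Hypothesis h0 : h 0 = 0.
Variable L : 'M[R]_(a, b).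
Hypothesis Lg0 : L *m g 0 = 1%:M.
Variables S W : 'cV[R]_b -> R.
Hypothesis S_C1 : continuously_differentiable S.
Hypothesis S_pos : positive_definite S.
Hypothesis S_unbounded : radially_unbounded S.
Hypothesis cW : continuous W.
Hypothesis W0 : W 0 = 0.
Hypothesis W_pos : forall a, a != 0 -> 0 < W a.
Hypothesis dissipation : forall a u,
  (grad S a *m (f a + g a *m u)) ord0 ord0 <= - W a + ((h a)^T *m u) ord0 ord0.
Variables (x : R -> 'cV[R]_a) (xi : R -> 'cV[R]_b).
Hypothesis solution :
  krasowskii_solution quantized_loop `[0, +oo[ (fun t => (x t, xi t)).

Local Notation z := (fun t => B^T *m x t).
Local Notation P := (potential Delta).

(* The last bound replaces the inclusion for xi': difference quotients of the *)
(* potential stand for the unnamed element of the convexified quantizer.      *)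
Definition regular_time (t : R) : Prop :=
  [/\ derivable x t 1, derivable xi t 1, derive1 x t = h (xi t) + v t &
    forall (r : 'rV[R]_b) tau, 0 < tau ->
      (r *m derive1 xi t) ord0 ord0 <= (r *m f (xi t)) ord0 ord0 +
        (P (z t - tau *: (B^T *m (r *m g (xi t))^T)) - P (z t)) / tau].

(** At fixed [t] this component is continuous in the state, so convexification does not enlarge
    it. *)
Lemma krasowskii_loop_fst t X Y : krasowskii (quantized_loop t) X Y ->
  Y.1 = h X.2 + v t.
Proof.
move=> KY; apply: eq_from_rows => r.
apply: (@krasowskii_le _ _ _ X Y (fun Z => (r *m Z.1) ord0 ord0)
  (fun Z => (r *m (h Z.2 + v t)) ord0 ord0) _ _ _ _ KY).
- apply: continuous_entry; apply: continuous_mulmx; first exact: cst_continuous.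
  exact: continuous_fst.
- by move=> k u w; rewrite /= mulmxDr -scalemxAr !mxE.
- by move=> Z.
- apply: continuous_entry; apply: continuous_mulmx; first exact: cst_continuous.
  move=> Z; apply: continuousD; last exact: cst_continuous.
  exact: (continuous_compose _ _ _ _ _ (continuous_snd _ _) ch).
Qed.

(** The quantized term contributes minus the pairing of the quantized output with [y = B^T (r g)^T],
    which the subgradient inequality at the point shifted by [- tau *: y] bounds by a quotient of
    [P]. That quotient, unlike the quantizer, is continuous in the state. *)
Lemma krasowskii_loop_snd t X Y (r : 'rV[R]_b) tau :
  krasowskii (quantized_loop t) X Y -> 0 < tau ->
  (r *m Y.2) ord0 ord0 <= (r *m f X.2) ord0 ord0 +
    (P (B^T *m X.1 - tau *: (B^T *m (r *m g X.2)^T)) - P (B^T *m X.1)) / tau.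
Proof.
move=> KY tau0.
apply: (@krasowskii_le _ _ _ X Y (fun Z => (r *m Z.2) ord0 ord0)
  (fun Z => (r *m f Z.2) ord0 ord0 +
    (P (B^T *m Z.1 - tau *: (B^T *m (r *m g Z.2)^T)) - P (B^T *m Z.1)) / tau)
  _ _ _ _ KY).
- apply: continuous_entry; apply: continuous_mulmx; first exact: cst_continuous.
  exact: continuous_snd.
- by move=> k u w; rewrite /= mulmxDr -scalemxAr !mxE.
- move=> Z /=; set q := map_mx _ _; set y := B^T *m (_)^T.
  have qy : (q^T *m y) ord0 ord0 = (r *m (g Z.2 *m B *m q)) ord0 ord0.
    by rewrite /y -!trmx_mul mxE !mulmxA.
  have := potential_subgradient _ Delta_gt0 (B^T *m Z.1)
    (B^T *m Z.1 - tau *: y).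
  rewrite -/q addrAC subrr add0r -scaleNr -scalemxAr [X in _ + X <= _]mxE qy.
  move=> sub; rewrite mulmxBr [leLHS]mxE [X in _ + X <= _]mxE lerD2l.
  by rewrite ler_pdivlMr//; lra.
- move: X {KY} => Z; apply: continuousD; move: Z.
    apply: continuous_entry; apply: continuous_mulmx; first exact: cst_continuous.
    exact: (continuous_compose _ _ _ _ _ (continuous_snd _ _) cf).
  have cz : continuous (fun Z : 'cV[R]_a * 'cV[R]_b => B^T *m Z.1).
    apply: continuous_mulmx; first exact: cst_continuous.
    exact: continuous_fst.
  have cP : continuous (P : 'cV[R]_c -> R).
    exact/ball_lipschitz_continuous/potential_lipschitz.
  have cy : continuous (fun Z : 'cV[R]_a * 'cV[R]_b =>
      B^T *m Z.1 - tau *: (B^T *m (r *m g Z.2)^T)).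
    move=> Z; apply: (@continuousB _ _ _ _
      (fun Z => tau *: (B^T *m (r *m g Z.2)^T))); first exact: cz.
    apply: (continuous_compose _ _ _ _ ( *:%R tau) _ (@scaler_continuous _ _ _)).
    apply: continuous_mulmx; first exact: cst_continuous.
    apply: continuous_trmx; apply: continuous_mulmx; first exact: cst_continuous.
    exact: (continuous_compose _ _ _ _ _ (continuous_snd _ _) cg).
  move=> Z; apply: continuousM; last exact: cst_continuous.
  apply: continuousB; first exact: (continuous_compose _ _ _ _ _ cy cP).
  exact: (continuous_compose _ _ _ _ _ cz cP).
Qed.

Lemma regular_time_ae :
  {ae (@lebesgue_measure R), forall t, 0 < t -> regular_time t}.
Proof.
apply: ae_impl solution.2 => t sol t0.
have /sol[/derive1_pair[dx dxi dX] KX] : t \in `[0, +oo[.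
  by rewrite in_itv /= ltW.
split=> //.
  by have := krasowskii_loop_fst _ _ _ KX; rewrite dX.
move=> r tau tau0.
by have := krasowskii_loop_snd _ _ _ r tau KX tau0; rewrite dX.
Qed.

(** Increment estimates along the solution all pass through here: [Psi] is absolutely continuous
    along it, so slopes need checking only at regular times. *)
Lemma solution_rate (s t k : R) (Psi : 'cV[R]_a * 'cV[R]_b -> R) :
  0 <= s -> s <= t -> ball_lipschitz Psi ->
  (forall u, s < u -> u <= t -> regular_time u ->
    left_slope_le (fun u => Psi (x u, xi u)) u k) ->
  Psi (x t, xi t) - Psi (x s, xi s) <= k * (t - s).
Proof.
move=> s0 st lipPsi slope.
have acX : abs_continuous s t (fun u => (x u, xi u)).
  by apply: solution.1; rewrite in_itv /= andbT// (le_trans s0).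
have [rho Xrho] := abs_continuous_bounded _ _ _ _ st acX.
have [K K0 lipK] := lipPsi rho.
apply: (@abs_continuous_rate _ _ _ _ (fun u => Psi (x u, xi u))) => //.
  apply: (abs_continuous_dom _ _ _ _ K K0 acX) => u w su uw wt.
  apply: le_trans (lipK (x u, xi u) (x w, xi w) _ _) _.
  - by apply: Xrho => //; exact: le_trans wt.
  - by apply: Xrho => //; exact: le_trans uw.
  - by rewrite ler_wpM2l// lerDl subr_ge0.
apply: ae_impl regular_time_ae => u reg su ut.
by apply: slope => //; apply: reg; exact: le_lt_trans su.
Qed.

(** * Decrease of the storage, boundedness, convergence of [xi] *)

Definition storage (t : R) : R := S (xi t) + P (z t).

Lemma W_ge0 e : 0 <= W e.
Proof. by have [->|/W_pos/ltW//] := eqVneq e 0; rewrite W0. Qed.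

Lemma S_ge0 e : 0 <= S e.
Proof.
by have [->|/S_pos.2/ltW//] := eqVneq e 0; rewrite S_pos.1.
Qed.

Lemma storage_ge0 t : 0 <= storage t.
Proof. by rewrite addr_ge0 ?S_ge0// potential_ge0. Qed.

Lemma norm_BT_le (u w : 'cV[R]_a) :
  `|B^T *m u - B^T *m w| <= a%:R * `|B^T| * `|u - w|.
Proof. by rewrite -mulmxBr norm_mulmx_le. Qed.

Lemma BT_bound_ge0 : 0 <= a%:R * `|B^T|. Proof. by rewrite mulr_ge0. Qed.

(** Test [xi'] against [grad S (xi u)]. As [grad S *m g] is [h^T], the shift of [z] in the bound is
    [tau] times [B^T h], that is [tau] times [z'], exactly the form that [left_slope_le_add]
    requires. *)
Lemma storage_rate s t w : 0 <= s -> s <= t ->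
  (forall u, s < u -> u <= t -> w <= W (xi u)) ->
  storage t - storage s <= - w * (t - s).
Proof.
move=> s0 st wW.
apply: (solution_rate s t _ (fun Y => S Y.2 + P (B^T *m Y.1))) => //.
  apply: ball_lipschitz_add.
    apply: (ball_lipschitz_comp snd S 1) => //.
      by move=> u u'; rewrite mul1r; exact: (norm_snd_le (u - u')).
    exact: ball_lipschitz_C1.
  apply: (ball_lipschitz_comp (fun Y : 'cV[R]_a * 'cV[R]_b => B^T *m Y.1) P _
    BT_bound_ge0).
  - by rewrite mulmx0.
  - move=> u u'; apply: le_trans (norm_BT_le _ _) _.
    by rewrite ler_wpM2l ?BT_bound_ge0//; exact: (norm_fst_le (u - u')).
  - exact: potential_lipschitz.
move=> u su ut [dx dxi dxE dxi_le] /=.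
have [dSxi dSxiE] := derive1_comp_grad _ S xi u (S_C1.1 _) dxi.
have [dz dzE] := derive1_mulmx _ _ B^T x u dx.
apply: (left_slope_le_add _ (S \o xi) z P) => //.
  exact: potential_lipschitz.
move=> tau tau0; rewrite dSxiE dzE dxE mulmxDr Bv0 addr0.
have [GF GK] := dissipation_affine _ _ _ _ _ _ _ (dissipation (xi u)).
have := dxi_le (grad S (xi u)) tau tau0; rewrite GK trmxK.
by have := wW u su ut; lra.
Qed.

Lemma storage_nonincr s t : 0 <= s -> s <= t -> storage t <= storage s.
Proof.
move=> s0 st; have := storage_rate s t 0 s0 st (fun u _ _ => W_ge0 _).
by rewrite oppr0 mul0r subr_le0.
Qed.

(** Each storage term dominates its argument: [S] is radially unbounded and [P] grows linearly. Only
    [z] is bounded, not [x]. *)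
Lemma solution_bounded :
  exists2 rho, 0 <= rho & forall t, 0 <= t -> `|xi t| <= rho /\ `|z t| <= rho.
Proof.
have [r rS] := S_unbounded (storage 0 + 1).
exists (Num.max `|r| (storage 0 / Delta + Delta / 2)).
  by rewrite le_max normr_ge0.
move=> t t0; have := storage_nonincr 0 t (lexx 0) t0 => Vt.
have := S_ge0 (xi t); have := potential_ge0 _ Delta_gt0 (z t) => P0 S0.
split; rewrite le_max; apply/orP.
  left; apply: ltW; apply: lt_le_trans (ler_norm r); rewrite ltNge.
  by apply/negP => /rS; move: Vt; rewrite {1}/storage; lra.
right; rewrite -lerBlDr ler_pdivlMr// mulrC.
apply: le_trans (potential_norm _ Delta_gt0 _) _.
by move: Vt; rewrite {1}/storage; lra.
Qed.

(** With [tau = 1], all terms bounding [r xi'] are continuous functions of bounded quantities,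
    uniformly over rows of norm at most 1. *)
Lemma xi_lipschitz : exists2 K, 0 <= K &
  forall s t, 0 <= s -> s <= t -> `|xi t - xi s| <= K * (t - s).
Proof.
have [rho rho0 Xrho] := solution_bounded.
have [Cf Cf0 fC] := continuous_bounded_ball _ _ _ rho cf.
have [Cg Cg0 gC] := continuous_bounded_ball _ _ _ rho cg.
have cP : continuous (P : 'cV[R]_c -> R).
  exact/ball_lipschitz_continuous/potential_lipschitz.
pose rho' := rho + a%:R * `|B^T| * (b%:R * Cg).
have [CP CP0 PC] := continuous_bounded_ball _ _ _ rho' cP.
exists (b%:R * Cf + CP); first by rewrite addr_ge0// mulr_ge0.
move=> s t s0 st; apply: norm_le_from_rows => [|r r1].
  by rewrite mulr_ge0 ?subr_ge0// addr_ge0// mulr_ge0.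
rewrite mulmxBr [leLHS]mxE [X in _ + X]mxE.
apply: (solution_rate s t _ (fun Y => (r *m Y.2) ord0 ord0)) => //.
  apply: (ball_lipschitz_comp snd (fun w => (r *m w) ord0 ord0) 1) => //.
    by move=> u u'; rewrite mul1r; exact: (norm_snd_le (u - u')).
  exact: ball_lipschitz_row.
move=> u su ut [_ dxi _ dxi_le] /=; apply: left_slope_le_row => //.
have u0 : 0 <= u by rewrite (le_trans s0)// ltW.
have [xiu zu] := Xrho u u0.
apply: le_trans (dxi_le r 1 ltr01) _; rewrite divr1 scale1r; apply: lerD.
  apply: le_trans (ler_norm _) _; apply: le_trans (norm_entry_le _ _ _ _ _) _.
  apply: le_trans (norm_mulmx_le _ _ _ _ _) _.
  apply: ler_pM; rewrite ?mulr_ge0// ?fC//.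
  by rewrite ler_piMr.
have := potential_ge0 _ Delta_gt0 (z u) => Pz0.
rewrite lerBlDr; apply: (@le_trans _ _ CP); last by rewrite lerDl.
apply: le_trans (ler_norm _) (PC _ _).
apply: le_trans (ler_normB _ _) _; apply: lerD => //.
apply: le_trans (norm_mulmx_le _ _ _ _ _) _; rewrite ler_wpM2l ?BT_bound_ge0//.
apply: le_trans (norm_trmx_le _ _ _) _.
apply: le_trans (norm_mulmx_le _ _ _ _ _) _.
apply: ler_pM; rewrite ?mulr_ge0// ?gC//.
by rewrite ler_piMr.
Qed.

(* Barbalat: storage converges while xi is Lipschitz, so xi cannot keep       *)
(* leaving a neighbourhood of 0.                                              *)
Lemma xi_cvg0 e : 0 < e ->
  exists2 T, 0 <= T & forall t, T <= t -> `|xi t| <= e.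
Proof.
move=> e0; have [rho rho0 Xrho] := solution_bounded.
have [K K0 xiK] := xi_lipschitz.
have e2 : 0 < e / 2 by rewrite divr_gt0.
have [w w0 wW] := positive_definite_shell _ W _ rho e2 cW W_pos.
have K1 : 0 < K + 1 by rewrite ltr_wpDl.
(* In time [d], [xi] moves by at most [e / 2]; an excursion beyond [e] therefore keeps
   [W (xi u) >= w] for that long and costs [w * d] of storage. *)
pose d := e / 2 / (K + 1).
have d0 : 0 < d by rewrite divr_gt0.
pose A := [set storage t | t in [set t | 0 <= t]].
have infA : has_inf A.
  split; first by exists (storage 0), 0 => //=.
  by exists 0 => _ [t _ <-]; exact: storage_ge0.
have wd0 : 0 < w * d by rewrite mulr_gt0.
(* After [T] less than [w * d] of storage remains above the infimum, too little for an excursion. *)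
have [_ [T T0 <-] VT] := inf_adherent wd0 infA.
exists T => // t Tt; rewrite leNgt; apply/negP => xit.
have t0 : 0 <= t := le_trans T0 Tt.
have td : t <= t + d by rewrite lerDl ltW.
have : storage (t + d) - storage t <= - w * (t + d - t).
  apply: storage_rate => // u tu utd.
  have u0 : 0 <= u by rewrite (le_trans t0)// ltW.
  apply: wW; last by have [] := Xrho u u0.
  have : `|xi u - xi t| <= e / 2.
    apply: le_trans (xiK _ _ t0 (ltW tu)) _.
    apply: (@le_trans _ _ ((K + 1) * d)).
      by apply: ler_pM; rewrite ?subr_ge0 ?(ltW tu)// ?lerDl//; lra.
    by rewrite /d mulrC divfK ?gt_eqF.
  have := ler_normB (xi u) (xi u - xi t); rewrite opprB addrCA subrr addr0.
  lra.
have : inf A <= storage (t + d).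
  by apply: ge_inf; [case: infA|exists (t + d) => //=; exact: le_trans td].
have := storage_nonincr T t T0 Tt; lra.
Qed.

(** * Convergence of [z] to the cube, and the derivative of [x] *)

Lemma continuous_xi_cvg0 (V : normedModType R) (Psi : 'cV[R]_b -> V) e :
  continuous Psi -> Psi 0 = 0 -> 0 < e ->
  exists2 T, 0 <= T & forall t, T <= t -> `|Psi (xi t)| <= e.
Proof.
move=> cPsi Psi0 e0.
have [d d0 Psid] := continuous_small_at0 _ _ _ _ cPsi Psi0 e0.
have d2 : 0 < d / 2 by rewrite divr_gt0.
have [T T0 xiT] := xi_cvg0 _ d2; exists T => // t Tt.
apply: Psid; rewrite (le_lt_trans (xiT t Tt))//.
by rewrite ltr_pdivrMr// ltr_pMr// ltr1n.
Qed.

(** [z'] is [B^T h(xi)], which tends to 0 with [xi]. *)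
Lemma z_slow eta : 0 < eta -> exists2 T, 0 <= T &
  forall s t, T <= s -> s <= t -> `|z t - z s| <= eta * (t - s).
Proof.
move=> eta0.
have c1 : 0 < c%:R + 1 :> R by rewrite ltr_wpDl.
have cBh : continuous (fun w => B^T *m h w).
  by apply: continuous_mulmx => //; exact: cst_continuous.
have Bh0 : B^T *m h 0 = 0 by rewrite h0 mulmx0.
have [T T0 BhT] := continuous_xi_cvg0 _ _ _ cBh Bh0 (divr_gt0 eta0 c1).
exists T => // s t Ts st; apply: norm_le_from_rows => [|r r1].
  by rewrite mulr_ge0 ?subr_ge0// ltW.
rewrite mulmxBr [leLHS]mxE [X in _ + X]mxE !mulmxA.
apply: (solution_rate s t _ (fun Y => (r *m B^T *m Y.1) ord0 ord0)) => //.
- exact: le_trans Ts.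
- apply: (ball_lipschitz_comp fst (fun w => (r *m B^T *m w) ord0 ord0) 1) => //.
    by move=> u u'; rewrite mul1r; exact: (norm_fst_le (u - u')).
  exact: ball_lipschitz_row.
- move=> u su ut [dx _ dxE _] /=; apply: left_slope_le_row => //.
  rewrite dxE mulmxDr -!mulmxA Bv0 mulmx0 addr0.
  apply: le_trans (ler_norm _) _; apply: le_trans (norm_entry_le _ _ _ _ _) _.
  apply: le_trans (norm_mulmx_le _ _ _ _ _) _.
  apply: (@le_trans _ _ ((c%:R + 1) * (eta / (c%:R + 1)))).
    apply: ler_pM; rewrite ?mulr_ge0//.
      by rewrite (@le_trans _ _ c%:R)// ?lerDl// ler_piMr.
    by apply: BhT; rewrite (le_trans Ts)// ltW.
  by rewrite mulrC divfK ?gt_eqF.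
Qed.

Lemma z_cvg e : 0 < e ->
  exists2 T, 0 <= T & forall t, T <= t -> `|z t| <= Delta / 2 + e.
Proof.
move=> e0; have [rho rho0 Xrho] := solution_bounded.
(* A generalized inverse recovers every vector in the range of [B^T], in particular [z t]. *)
have [A BAB] : exists A : 'M[R]_(a, c), B^T *m A *m B^T = B^T.
  by exists (pinvmx B^T); exact: mulmxKpV.
have BAz t : B^T *m (A *m z t) = z t by rewrite /= !mulmxA BAB.
pose Cr := a%:R * (c%:R * `|A| * rho) * `|L|.
have Cr0 : 0 <= Cr by rewrite !mulr_ge0.
have rCr t : 0 <= t -> `|(A *m z t)^T *m L| <= Cr.
  move=> t0; apply: le_trans (norm_mulmx_le _ _ _ _ _) _.
  rewrite ler_wpM2r// ler_wpM2l// (le_trans (norm_trmx_le _ _ _))//.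
  apply: le_trans (norm_mulmx_le _ _ _ _ _) _; rewrite ler_wpM2l ?mulr_ge0//.
  by have [] := Xrho t t0.
have absorb (C k : R) : 0 <= C -> 0 < k -> C * (k / (C + 1)) <= k.
  move=> C0 k0; have C1 : 0 < C + 1 by rewrite ltr_wpDl.
  by rewrite mulrCA ger_pMr// ler_pdivrMr// mul1r lerDl.
have pos (C k : R) : 0 <= C -> 0 < k -> 0 < k / (C + 1).
  by move=> C0 k0; rewrite divr_gt0// ltr_wpDl.
pose m := Delta * (e / 5).
have e5 : 0 < e / 5 by rewrite divr_gt0.
have m0 : 0 < m by rewrite mulr_gt0.
have [d d0 Pd] := continuous_small_at0 _ _ (P : 'cV[R]_c -> R) m
  (ball_lipschitz_continuous _ _ (potential_lipschitz _ Delta_gt0))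
  (potential0 _ Delta_gt0) m0.
have d3 : 0 < d / 3 by rewrite divr_gt0.
have bCr0 : 0 <= b%:R * Cr by rewrite mulr_ge0.
have [T1 T10 T1f] := continuous_xi_cvg0 _ _ _ cf f0 (pos _ _ bCr0 m0).
have [T2 T20 T2xi] := xi_cvg0 _ (pos _ _ bCr0 m0).
have C40 : 0 <= a%:R * `|B^T| * (b%:R * Cr) by rewrite !mulr_ge0.
have cgB : continuous (fun w => g w - g 0).
  by move=> w; apply: continuousB; [exact: cg|exact: cst_continuous].
have [T3 T30 T3g] := continuous_xi_cvg0 _ _ _ cgB (subrr _) (pos _ _ C40 d3).
have eta0 : 0 < Num.min (d / 3) (e / 5) by rewrite lt_min d3.
have [T4 T40 T4z] := z_slow _ eta0.
exists (Num.max (Num.max T1 T2) (Num.max T3 T4)).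
  by rewrite !le_max T10.
move=> t; rewrite !ge_max => /andP[/andP[tT1 tT2] /andP[tT3 tT4]].
have t0 : 0 <= t := le_trans T10 tT1.
have tt1 : t <= t + 1 by rewrite lerDl.
pose r := (A *m z t)^T *m L.
have rc : `|r| <= Cr := rCr t t0.
have row_small (w : 'cV[R]_b) : `|w| <= m / (b%:R * Cr + 1) ->
    `|(r *m w) ord0 ord0| <= m.
  move=> wm; apply: le_trans (norm_entry_le _ _ _ _ _) _.
  apply: le_trans (norm_mulmx_le _ _ _ _ _) _.
  apply: le_trans (absorb _ _ bCr0 m0).
  by apply: ler_pM; rewrite ?mulr_ge0// ler_wpM2l.
have rate : (r *m xi (t + 1)) ord0 ord0 - (r *m xi t) ord0 ord0 <=
    (m + m - Delta * (`|z t| - e / 5 - Delta / 2)) * (t + 1 - t).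
  apply: (solution_rate t (t + 1) _ (fun Y => (r *m Y.2) ord0 ord0)) => //.
    apply: (ball_lipschitz_comp snd (fun w => (r *m w) ord0 ord0) 1) => //.
      by move=> u u'; rewrite mul1r; exact: (norm_snd_le (u - u')).
    exact: ball_lipschitz_row.
  move=> u /ltW tu ut1 [_ dxi _ dxi_le] /=; apply: left_slope_le_row => //.
  apply: le_trans (dxi_le r 1 ltr01) _; rewrite divr1 scale1r -addrA.
  apply: lerD.
    apply: le_trans (ler_norm _) _; apply: row_small; apply: T1f.
    exact: le_trans tu.
  have zz : `|z u - z t| <= Num.min (d / 3) (e / 5).
    apply: le_trans (T4z t u tT4 tu) _.
    by apply: ler_piMr; [exact: ltW|lra].
  apply: lerD.
    apply: le_trans (ler_norm _) (Pd _ _).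
    (* Replacing [g (xi u)] by [g 0] would make the shift exactly [z t], because [L *m g 0] is the
       identity; what remains is the drift of [z] and of [g], both small. *)
    have -> : z u - B^T *m (r *m g (xi u))^T =
        (z u - z t) - B^T *m (r *m (g (xi u) - g 0))^T.
      rewrite [r *m (_ - _)]mulmxBr /r -[_ *m L *m g 0]mulmxA Lg0 mulmx1.
      by rewrite linearB /= trmxK mulmxBr BAz; rewrite opprB addrA subrK.
    apply: le_lt_trans (ler_normB _ _) _.
    apply: (@le_lt_trans _ _ (d / 3 + d / 3)); last by lra.
    apply: lerD; first by rewrite (le_trans zz)// ge_min lexx.
    apply: le_trans (norm_mulmx_le _ _ _ _ _) _.
    apply: le_trans (absorb _ _ C40 d3); rewrite -[leRHS]mulrA.
    rewrite ler_wpM2l ?BT_bound_ge0// (le_trans (norm_trmx_le _ _ _))//.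
    apply: le_trans (norm_mulmx_le _ _ _ _ _) _.
    apply: ler_pM; rewrite ?mulr_ge0//; first by rewrite ler_wpM2l.
    by apply: T3g; exact: le_trans tu.
  rewrite lerN2; apply: le_trans (potential_norm _ Delta_gt0 _).
  rewrite ler_pM2l// lerD2r lerBlDr.
  rewrite -[z t](subKr (z u)) (le_trans (ler_normB _ _))// lerD2l.
  by rewrite (le_trans zz)// ge_min lexx orbT.
have := row_small _ (T2xi t tT2).
have := row_small _ (T2xi (t + 1) (le_trans tT2 tt1)).
rewrite !ler_norml => /andP[lo1 hi1] /andP[lo2 hi2].
move: rate; rewrite [t + 1 - t]addrAC subrr add0r mulr1 => rate.
(* Two of the four [m] come from the rate, two from [r xi] at the ends of the unit interval; the
   fifth [e / 5] is the drift of [z]. *)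
have : Delta * (`|z t| - e / 5 - Delta / 2) <= Delta * (4 * (e / 5)).
  by move: rate lo1 hi1 lo2 hi2; rewrite /m; lra.
by rewrite ler_pM2l//; lra.
Qed.

(** The inclusion holds only almost everywhere and [t] may be exceptional. But [h(xi) + v] is
    continuous at [t], so its nearby values control the increments of [x] over [[t, t + d]], hence
    the derivative at [t]. *)
Lemma derive1_x t : 0 < t -> derivable x t 1 -> {for t, continuous v} ->
  derive1 x t = h (xi t) + v t.
Proof.
move=> t0 dx cv; apply: eq_from_rows => r; apply/ler_addgt0Pr => e e0.
have [K K0 xiK] := xi_lipschitz.
have cxi : {for t, continuous xi}.
  apply/cvgrPdist_le => k k0; apply/nbhs_ballP.
  exists (Num.min t (k / (K + 1))).
    by rewrite /= lt_min t0 divr_gt0// ltr_wpDl.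
  move=> s; rewrite /ball /= lt_min => /andP[ts tsk].
  have s0 : 0 <= s by move: ts; rewrite ltr_norml; lra.
  have K1 : 0 < K + 1 by rewrite ltr_wpDl.
  move: tsk; rewrite ltr_pdivlMr// => tsk.
  apply: (@le_trans _ _ (`|t - s| * (K + 1))); last exact: ltW.
  apply: (@le_trans _ _ (K * `|t - s|)).
    have [st|/ltW st] := leP s t.
      by rewrite (ger0_norm (x := t - s)) ?subr_ge0// xiK.
    by rewrite distrC [`|t - s|]distrC (ger0_norm (x := s - t)) ?subr_ge0//
      xiK// ltW.
  by rewrite mulrC ler_wpM2l// lerDl.
have e2 : 0 < e / 2 by rewrite divr_gt0.
have crhs : {for t, continuous (fun s => (r *m (h (xi s) + v s)) ord0 ord0)}.
  apply: cvg_entry; apply: cvg_mulmx; first exact: cvg_cst.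
  by apply: cvgD => //; apply: continuous_comp => //; exact: ch.
move/cvgrPdist_le: crhs => /(_ _ e2) /nbhs_ballP[d1 /= d10 rhs].
have [dr drE] := derive1_mulmx _ _ r x t dx.
have [d2 d20 app] := derivable_approx _ _ _ dr _ e2.
pose d := Num.min d1 d2 / 2.
have dd : Num.min d1 d2 = d + d by rewrite /d -splitr.
have d0 : 0 < d by rewrite divr_gt0// lt_min d10.
have dd1 : d < d1 by have := ge_min d1 d1 d2; rewrite lexx dd; lra.
have dd2 : d < d2 by have := ge_min d2 d1 d2; rewrite lexx orbT dd; lra.
have rate : (r *m x (t + d)) ord0 ord0 - (r *m x t) ord0 ord0 <=
    ((r *m (h (xi t) + v t)) ord0 ord0 + e / 2) * (t + d - t).
  apply: (solution_rate t (t + d) _ (fun Y => (r *m Y.1) ord0 ord0)).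
  - exact: ltW.
  - by rewrite lerDl ltW.
  - apply: (ball_lipschitz_comp fst (fun w => (r *m w) ord0 ord0) 1) => //.
      by move=> u u'; rewrite mul1r; exact: (norm_fst_le (u - u')).
    exact: ball_lipschitz_row.
  move=> u tu utd [dxu _ dxuE _] /=; apply: left_slope_le_row => //.
  rewrite dxuE; have := rhs u.
  rewrite /ball /= ltr_norml ler_norml; have -> : - d1 < t - u < d1 by lra.
  by move=> /(_ isT); lra.
have := app (t + d); rewrite [t + d - t]addrAC subrr add0r (gtr0_norm d0) => /(_ dd2).
move=> /(le_trans (norm_entry_le _ _ _ ord0 ord0)).
have entries (p q w : 'M[R]_1) : (p - q - d *: w) ord0 ord0 =
    p ord0 ord0 - q ord0 ord0 - d * w ord0 ord0 by rewrite !mxE.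
rewrite drE entries ler_norml.
move: rate; rewrite [t + d - t]addrAC subrr add0r.
set p := (r *m x (t + d)) _ _; set q := (r *m x t) _ _.
move=> rate /andP[lo _].
rewrite -(ler_pM2r d0); lra.
Qed.

End Loop.

(** * From the individual subsystems to the stacked one *)

Section Stacking.
Context {R : realType} {N p : nat} {n : 'I_N -> nat}.

Lemma submxcolE m k (q : 'I_k -> nat) (w : 'M[R]_(\sum_(i < k) q i, m)) i :
  submxcol w i = submxcol (1%:M : 'M[R]_(\sum_(i < k) q i)) i *m w.
Proof. by rewrite submxcol_mul mul1mx. Qed.

Lemma norm_mxcol_le k (q : 'I_k -> nat) (w : 'cV[R]_(\sum_(i < k) q i)) C :
  0 <= C -> (forall i, `|submxcol w i| <= C) -> `|w| <= C.
Proof.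
move=> C0 wC; apply: mx_norm_le => // s j.
rewrite -[w]submxcolK mxE; apply: le_trans (norm_entry_le _ _ _ _ _) (wC _).
Qed.

Lemma norm_submxcol_le k (q : 'I_k -> nat) (w : 'cV[R]_(\sum_(i < k) q i)) i :
  `|submxcol w i| <= `|w|.
Proof. by apply: mx_norm_le => // s j; rewrite mxE norm_entry_le. Qed.

Lemma submxcol_neq0 k (q : 'I_k -> nat) (w : 'cV[R]_(\sum_(i < k) q i)) :
  w != 0 -> exists i, submxcol w i != 0.
Proof.
move=> w0; apply/existsP; apply: contraNT w0 => /existsPn w0.
apply/eqP/mxcolP => i; rewrite submxcol0; apply/eqP.
by move: (w0 i); rewrite negbK.
Qed.

Lemma mul_diag_row m (C : forall i, 'M[R]_(n i, p)) (U : 'I_N -> 'M[R]_(p, m)) :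
  (\mxblock_(i < N, j < N) (if i == j then C i else 0)) *m (\mxcol_i U i)
  = \mxcol_i (C i *m U i).
Proof.
rewrite mul_mxblock_mxrow; apply: eq_mxcol => i.
rewrite (bigD1 i)//= eqxx big1 ?addr0// => j ji.
by rewrite eq_sym (negPf ji) mul0mx.
Qed.

Lemma mul_diag_col m (C : forall i, 'M[R]_(p, n i))
    (U : forall i, 'M[R]_(n i, m)) :
  (\mxblock_(i < N, j < N) (if i == j then C j else 0)) *m (\mxcol_i U i)
  = \mxcol_i (C i *m U i).
Proof.
rewrite mul_mxblock_mxrow; apply: eq_mxcol => i.
rewrite (bigD1 i)//= eqxx big1 ?addr0// => j ji.
by rewrite eq_sym (negPf ji) mul0mx.
Qed.

Variables (f : forall i, 'cV[R]_(n i) -> 'cV[R]_(n i))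
  (g : forall i, 'cV[R]_(n i) -> 'M[R]_(n i, p))
  (h : forall i, 'cV[R]_(n i) -> 'cV[R]_p).

Lemma diag_g_left_inverse : (forall i, \rank (g i 0) = p) ->
  exists L, L *m diag_g g 0 = 1%:M.
Proof.
move=> g0.
have Lg i : exists L, L *m g i 0 = 1%:M by apply/row_fullP; rewrite /row_full g0.
pose L i := sval (cid (Lg i)).
exists (\mxblock_(i < N, j < N) (if i == j then L j else 0)).
rewrite -[RHS](submxcolK (1%:M : 'M[R]_(\sum_(i < N) p))).
rewrite -[LHS]mulmx1 -[1%:M in LHS]submxcolK -mulmxA /diag_g mul_diag_row.
rewrite mul_diag_col; apply: eq_mxcol => i.
by rewrite mulmxA submxcol0 (svalP (cid (Lg i))) mul1mx.
Qed.

(** Sums of the individual storage and dissipation functions work, [g] being block diagonal. Blocks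
    are extracted by the matrices [E i], so that differentiability comes from linearity. *)
Lemma strictly_passive_stack :
  (forall i, strictly_passive (f i) (g i) (h i)) ->
  strictly_passive (stack_f f) (diag_g g) (stack_h h).
Proof.
move=> passive.
pose S i := sval (cid (passive i)).
pose W i := sval (cid (svalP (cid (passive i)))).
have SW i : [/\ [/\ continuously_differentiable (S i), positive_definite (S i)
          & radially_unbounded (S i)],
        [/\ continuous (W i), W i 0 = 0 & forall a, a != 0 -> 0 < W i a]
      & forall xi u, (grad (S i) xi *m (f i xi + g i xi *m u)) ord0 ord0
            <= - W i xi + ((h i xi)^T *m u) ord0 ord0].
  exact: (svalP (cid (svalP (cid (passive i))))).
pose E i := submxcol (1%:M : 'M[R]_(\sum_(i < N) n i)) i.
have cE i : continuous (fun w : 'cV[R]_(\sum_(i < N) n i) => E i *m w).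
  by apply: continuous_mulmx; [exact: cst_continuous|move=> w; exact: cvg_id].
have dE i w : differentiable (mulmx (E i) : 'cV[R]__ -> 'cV[R]__) w.
  exact/linear_differentiable/cE.
have S_ge0 i w : 0 <= S i w.
  have [[_ [S0 Spos] _] _ _] := SW i.
  by have [->|/Spos/ltW//] := eqVneq w 0; rewrite S0.
have W_ge0 i w : 0 <= W i w.
  have [_ [_ W0 Wpos] _] := SW i.
  by have [->|/Wpos/ltW//] := eqVneq w 0; rewrite W0.
have dSE i w : differentiable (S i \o mulmx (E i)) w.
  by apply: differentiable_comp => //; have [[[dS _] _ _] _ _] := SW i.
pose St : 'cV[R]_(\sum_(i < N) n i) -> R :=
  \sum_(i < N) (S i \o mulmx (E i)).
have StE w : St w = \sum_i S i (E i *m w) by rewrite /St fct_sumE.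
have dSt w : differentiable St w by exact: differentiable_sum.
have dStE w (e : 'cV[R]_(\sum_(i < N) n i)) : (grad St w *m e) ord0 ord0 =
    \sum_i (grad (S i) (E i *m w) *m (E i *m e)) ord0 ord0.
  rewrite -(diff_grad _ St w e (dSt w)) -deriveE//.
  rewrite derive_sum => [|i]; last exact: diff_derivable.
  apply: eq_bigr => i _; rewrite deriveE// diff_comp//=; last first.
    by have [[[dS _] _ _] _ _] := SW i.
  rewrite diff_lin; last exact: cE.
  by rewrite diff_grad//; have [[[dS _] _ _] _ _] := SW i.
exists St, (fun w => \sum_i W i (E i *m w)); split.
- split.
  + split=> //; apply: continuous_mx => j k.
    have -> : (fun w => grad St w j k) = (fun w =>
        \sum_i (grad (S i) (E i *m w) *m (E i *m
          (delta_mx k ord0 : 'cV[R]_(\sum_(i < N) n i)))) ord0 ord0).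
      by apply/funext => w; rewrite -dStE -colE [RHS]mxE ord1.
    apply: continuous_bigsum => i.
    apply: continuous_entry; apply: continuous_mulmx; last exact: cst_continuous.
    apply: continuous_compose; first exact: cE.
    by have [[[_ cS] _ _] _ _] := SW i.
  + split=> [|w w0]; rewrite StE.
      by rewrite big1 // => i _; rewrite mulmx0; have [[_ [S0 _] _] _ _] := SW i.
    have [i wi] := submxcol_neq0 _ _ _ w0; rewrite (bigD1 i)//=.
    rewrite ltr_pwDl ?sumr_ge0//; have [[_ [_ Spos] _] _ _] := SW i.
    by apply: Spos; rewrite -submxcolE.
  + move=> C.
    have rS i : exists r, forall w, r <= `|w| -> C <= S i w.
      by have [[_ _ rS] _ _] := SW i; exact: rS.
    pose r i := sval (cid (rS i)).
    (* If the sum is below [C], so is each nonnegative summand; every block is then shorter than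
       [|r i|], which bounds the maximum norm of [w]. *)
    exists (\sum_i `|r i| + 1) => w rw; rewrite leNgt; apply/negP => SC.
    suff : `|w| <= \sum_i `|r i| by move: rw; lra.
    apply: norm_mxcol_le => [|i]; first exact: sumr_ge0.
    rewrite (bigD1 i)//=; apply: (@le_trans _ _ `|r i|); last first.
      by rewrite lerDl sumr_ge0.
    apply: ltW; apply: lt_le_trans (ler_norm _); rewrite ltNge; apply/negP.
    move=> /(svalP (cid (rS i))) CS; move: SC; rewrite ltNge StE; apply/negP.
    rewrite negbK; apply: le_trans CS _; rewrite submxcolE -/(E i).
    by rewrite [leRHS](bigD1 i)//= lerDl sumr_ge0.
- split.
  + apply: continuous_bigsum => i.
    apply: continuous_compose; first exact: cE.
    by have [_ [cW _ _] _] := SW i.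
  + by rewrite big1 // => i _; rewrite mulmx0; have [_ [_ W0 _] _] := SW i.
  + move=> w w0; have [i wi] := submxcol_neq0 _ _ _ w0; rewrite (bigD1 i)//=.
    rewrite ltr_pwDl ?sumr_ge0//; have [_ [_ _ Wpos] _] := SW i.
    by apply: Wpos; rewrite -submxcolE.
- move=> w u; rewrite dStE.
  rewrite -[u]submxcolK /diag_g mul_diag_row /stack_f -mxcolD /stack_h.
  rewrite tr_mxcol mul_mxrow_mxcol summxE -sumrN -big_split /=.
  apply: ler_sum => i _; rewrite -[E i *m \mxcol__ _]submxcolE mxcolK.
  by rewrite -submxcolE; have [_ _ dis] := SW i; exact: dis.
Qed.

Lemma lipschitz_continuous (V1 V2 : normedModType R) (F : V1 -> V2) :
  [locally [lipschitz F a | a in setT]] -> continuous F.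
Proof.
move=> lipF w; apply/cvgrPdist_le => e e0.
have := lipF (w, w) ltac:(by []).
move=> /pinfty_ex_gt0[K K0]; rewrite /within /= => /nbhs_ballP[d /= d0 FK].
apply/nbhs_ballP; exists (Num.min d (e / K)).
  by rewrite /= lt_min d0 divr_gt0.
move=> s; rewrite -ball_normE /= lt_min => /andP[wsd wse].
have := FK (w, s); rewrite /= => FKs.
apply: le_trans (FKs _ _) _ => //.
  by split; [exact: ballxx|rewrite -ball_normE].
by rewrite mulrC -ler_pdivlMr// ltW.
Qed.

Lemma continuous_submxcol i :
  continuous (fun w : 'cV[R]_(\sum_(i < N) n i) => submxcol w i).
Proof.
have -> : (fun w : 'cV[R]_(\sum_(i < N) n i) => submxcol w i) =
    (fun w => submxcol (1%:M : 'M[R]_(\sum_(i < N) n i)) i *m w).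
  by apply/funext => w; exact: submxcolE.
by apply: continuous_mulmx; [exact: cst_continuous|move=> w; exact: cvg_id].
Qed.

Lemma continuous_mxcol {T : topologicalType} k (q : 'I_k -> nat) m
    (F : forall i, T -> 'M[R]_(q i, m)) :
  (forall i, continuous (F i)) -> continuous (fun t => \mxcol_i F i t).
Proof.
move=> cF; apply: continuous_mx => s j.
have -> : (fun t => (\mxcol_i F i t) s j) =
    (fun t => F (tagnat.sig1 s) t (tagnat.sig2 s) j).
  by apply/funext => t; rewrite mxE.
exact: continuous_entry.
Qed.

Lemma continuous_stack_f : (forall i, continuous (f i)) -> continuous (stack_f f).
Proof.
move=> cf; apply: continuous_mxcol => i; apply: continuous_compose.
  exact: continuous_submxcol.
exact: cf.
Qed.

Lemma continuous_stack_h : (forall i, continuous (h i)) -> continuous (stack_h h).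
Proof.
move=> ch; apply: continuous_mxcol => i; apply: continuous_compose.
  exact: continuous_submxcol.
exact: ch.
Qed.

Lemma continuous_diag_g : (forall i, continuous (g i)) -> continuous (diag_g g).
Proof.
move=> cg; apply: continuous_mx => s j.
have -> : (fun w => diag_g g w s j) = (fun w =>
    (if tagnat.sig1 s == tagnat.sig1 j
     then g (tagnat.sig1 s) (submxcol w (tagnat.sig1 s)) else 0)
    (tagnat.sig2 s) (tagnat.sig2 j)).
  by apply/funext => w; rewrite mxE.
case: (_ == _); apply: continuous_entry; last exact: cst_continuous.
by apply: continuous_compose; [exact: continuous_submxcol|exact: cg].
Qed.

End Stacking.

(** * Incidence matrices and Kronecker products *)

Section Incidence.
Context {R : realType} {N M p : nat}.

Lemma kron_tr (D : 'M[R]_(N, M)) :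
  kron D^T (1%:M : 'M[R]_p) = (kron D (1%:M : 'M[R]_p))^T.
Proof.
rewrite /kron tr_mxblock; apply: eq_mxblock => i j.
by rewrite linearZ /= trmx1 mxE.
Qed.

Lemma incidence_col_sum (G : ugraph N M) (D : 'M[R]_(N, M)) :
  incidence_matrix G D -> forall k, \sum_i D i k = 0.
Proof.
move=> [pos [neg [edgeE ->]]] k.
have pn : neg k != pos k.
  apply/negP => /eqP pn; have := card_edge G k.
  by rewrite edgeE pn finset.setUid cards1.
rewrite (bigD1 (pos k))//= (bigD1 (neg k))//= !mxE !eqxx (negPf pn) big1.
  by rewrite addr0 subrr.
by move=> i /andP[ip im]; rewrite mxE (negPf ip) (negPf im).
Qed.

Lemma kron_ones_eq0 (D : 'M[R]_(N, M)) (w : 'cV[R]_p) :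
  (forall k, \sum_i D i k = 0) ->
  (kron D (1%:M : 'M[R]_p))^T *m kron_col (const_mx 1 : 'cV[R]_N) w = 0.
Proof.
move=> D0; rewrite -kron_tr /kron /kron_col mul_mxblock_mxrow.
rewrite -[RHS]mxcol0; apply: eq_mxcol => k.
under eq_bigr do rewrite -scalemxAl mul1mx !mxE scale1r.
by rewrite -scaler_suml D0 scale0r.
Qed.

End Incidence.

(** Turns closeness of [z] to the cube into closeness of [x] to the limit set, uniformly although
    [x] may be unbounded. Radial scaling keeps [z] in the range of [D^T], so a correction of [x] of
    size proportional to the excess realizes it. *)
Lemma limit_set_near {R : realType} {N M p : nat} {n : 'I_N -> nat}
    (D : 'M[R]_(N, M)) (Delta : R) : 0 < Delta ->
  exists2 C : R, 0 <= C & forall (x : 'cV[R]_(\sum_(i < N) p)) e, 0 <= e ->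
    `|relative D x| <= Delta / 2 + e ->
    exists2 x', limit_set D Delta (x', 0 : 'cV[R]_(\sum_(i < N) n i)) &
      `|x - x'| <= C * e.
Proof.
move=> Delta0; have D2 : 0 < Delta / 2 by rewrite divr_gt0.
have cube (x : 'cV[R]_(\sum_(i < N) p)) : `|relative D x| <= Delta / 2 ->
    limit_set D Delta (x, 0 : 'cV[R]_(\sum_(i < N) n i)).
  move=> xD; split=> // k j /=; rewrite in_itv /= -ler_norml.
  apply: le_trans (norm_entry_le _ _ _ _ _) (le_trans _ xD).
  exact: norm_submxcol_le.
have [A BAB] : exists A, kron D^T (1%:M : 'M[R]_p) *m A *m kron D^T 1%:M =
    kron D^T 1%:M by exists (pinvmx (kron D^T 1%:M)); exact: mulmxKpV.
exists ((\sum_(k < M) p)%:R * `|A|) => [|x e e0]; first by rewrite mulr_ge0.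
set z := relative D x => ze.
have [zD|Dz] := leP `|z| (Delta / 2).
  exists x; first exact: cube.
  by rewrite subrr normr0 !mulr_ge0.
have z0 : 0 < `|z| := lt_trans D2 Dz.
pose l := Delta / 2 / `|z|.
have l0 : 0 <= l by rewrite divr_ge0// ltW.
have l1 : l <= 1 by rewrite ler_pdivrMr// mul1r ltW.
exists (x - (1 - l) *: (A *m z)).
  apply: cube; rewrite /relative mulmxBr -scalemxAr /z /relative !mulmxA BAB.
  rewrite -/(relative D x) -/z scalerBl scale1r opprB addrCA subrr addr0.
  by rewrite normrZ (ger0_norm l0) divfK ?gt_eqF.
rewrite opprB addrCA subrr addr0 normrZ ger0_norm ?subr_ge0//.
apply: (@le_trans _ _ ((1 - l) * ((\sum_(k < M) p)%:R * `|A| * `|z|))).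
  by rewrite ler_wpM2l ?subr_ge0// norm_mulmx_le.
rewrite mulrCA ler_wpM2l ?mulr_ge0// mulrBl mul1r divfK ?gt_eqF//.
by rewrite lerBlDl.
Qed.

(** * Distance to the limit set and conclusion *)

Lemma edist_inf_cvg0 {R : realType} {V1 V2 : normedModType R}
    (A : set (V1 * V2)) (X : R -> V1 * V2) :
  (forall e, 0 < e -> exists T, forall t, T <= t ->
     exists2 Y, A Y & `|X t - Y| < e) ->
  edist_inf A (X t) @[t --> +oo%R] --> 0%E.
Proof.
move=> XA.
have small e : 0 < e -> \forall t \near +oo, (edist_inf A (X t) <= e%:E)%E.
  move=> e0; have [T XT] := XA e e0; exists T; split; first exact: num_real.
  move=> t /ltW /XT[Y AY XY].
  apply: (@le_trans _ _ (edist (X t, Y))); first by apply: ereal_inf_lbound; exists Y.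
  by apply: edist_fin => //=; rewrite -ball_normE.
apply/fine_cvgP; split.
  apply: filterS (small 1 ltr01) => t te.
  by rewrite ge0_fin_numE; [exact: le_lt_trans te (ltry _)|exact: edist_inf_ge0].
apply/cvgrPdist_le => e e0; apply: filterS (small e e0) => t te /=.
have te_fin : edist_inf A (X t) \is a fin_num.
  by rewrite ge0_fin_numE; [exact: le_lt_trans te (ltry _)|exact: edist_inf_ge0].
have fine_te : 0 <= fine (edist_inf A (X t)) by exact/fine_ge0/edist_inf_ge0.
by rewrite sub0r normrN ger0_norm// -lee_fin fineK.
Qed.

Lemma closed_loopE {R : realType} {N M p : nat} {n : 'I_N -> nat}
    (D : 'M[R]_(N, M)) (f : forall i, 'cV[R]_(n i) -> 'cV[R]_(n i))
    (g : forall i, 'cV[R]_(n i) -> 'M[R]_(n i, p))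
    (h : forall i, 'cV[R]_(n i) -> 'cV[R]_p) (v : R -> 'cV[R]_p) (Delta : R) :
  closed_loop D f g h v Delta =
  quantized_loop (kron D 1%:M) (stack_f f) (diag_g g) (stack_h h)
    (fun t => kron_col (const_mx 1 : 'cV[R]_N) (v t)) Delta.
Proof.
apply/funext => t; apply/funext => -[x xi].
by rewrite /quantized_loop /= -kron_tr.
Qed.

Theorem theorem2 (R : realType) (N M p : nat) (n : 'I_N -> nat)
    (G : ugraph N M) (D : 'M[R]_(N, M))
    (G_connected : connected_graph G) (D_incidence : incidence_matrix G D)
    (f : forall i, 'cV[R]_(n i) -> 'cV[R]_(n i))
    (g : forall i, 'cV[R]_(n i) -> 'M[R]_(n i, p))
    (h : forall i, 'cV[R]_(n i) -> 'cV[R]_p)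
    (f_lip : forall i, [locally [lipschitz f i a | a in setT]])
    (g_lip : forall i, [locally [lipschitz g i a | a in setT]])
    (h_lip : forall i, [locally [lipschitz h i a | a in setT]])
    (f0 : forall i, f i 0 = 0) (h0 : forall i, h i 0 = 0)
    (g0 : forall i, \rank (g i 0) = p)
    (passive : forall i, strictly_passive (f i) (g i) (h i))
    (v : R -> 'cV[R]_p)
    (v_bounded : [bounded v t | t in `[0, +oo[%classic])
    (v_pwc : piecewise_continuous v)
    (Delta : R) (Delta_gt0 : 0 < Delta)
    (x : R -> 'cV[R]_(\sum_(i < N) p))
    (xi : R -> 'cV[R]_(\sum_(i < N) n i))
    (solution : krasowskii_solution (closed_loop D f g h v Delta) `[0, +oo[
                  (fun t => (x t, xi t))) :
  edist_inf (limit_set D Delta) (x t, xi t) @[t --> +oo%R] --> 0%E /\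
  {ae (@lebesgue_measure R), forall t, 0 <= t -> derivable x t 1} /\
  derive1 x t - kron_col (const_mx 1 : 'cV[R]_N) (v t)
    @[t --> within (derivative_times x v) +oo%R]
    --> (0 : 'cV[R]_(\sum_(i < N) p)).
Proof.
have x_derivable : {ae (@lebesgue_measure R),
    forall t, 0 <= t -> derivable x t 1}.
  apply: ae_impl solution.2 => t sol t0.
  by have /sol[/derive1_pair[]] : t \in `[0, +oo[ by rewrite in_itv /= t0.
rewrite closed_loopE in solution.
pose B := kron D (1%:M : 'M[R]_p).
have cf := continuous_stack_f f (fun i => lipschitz_continuous _ _ _ (f_lip i)).
have cg := continuous_diag_g g (fun i => lipschitz_continuous _ _ _ (g_lip i)).
have ch := continuous_stack_h h (fun i => lipschitz_continuous _ _ _ (h_lip i)).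
have sf0 : stack_f f 0 = 0.
  by rewrite -[RHS]mxcol0; apply: eq_mxcol => i; rewrite submxcol0.
have sh0 : stack_h h 0 = 0.
  by rewrite -[RHS]mxcol0; apply: eq_mxcol => i; rewrite submxcol0.
have [L Lg0] := diag_g_left_inverse g g0.
have Bv0 t : B^T *m kron_col (const_mx 1 : 'cV[R]_N) (v t) = 0.
  exact/kron_ones_eq0/incidence_col_sum/D_incidence.
have [S [W [[S_C1 S_pos S_unb] [cW W0 W_pos] diss]]] :=
  strictly_passive_stack f g h passive.
have xi_to0 := xi_cvg0 B _ _ _ _ _ Delta_gt0 Bv0 cf cg ch S W S_C1 S_pos S_unb
  cW W0 W_pos diss x xi solution.
have h_to0 := continuous_xi_cvg0 B _ _ _ _ _ Delta_gt0 Bv0 cf cg ch S W S_C1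
  S_pos S_unb cW W0 W_pos diss x xi solution _ _ _ ch sh0.
have z_to_cube := z_cvg B _ _ _ _ _ Delta_gt0 Bv0 cf cg ch sf0 sh0 L Lg0 S W
  S_C1 S_pos S_unb cW W0 W_pos diss x xi solution.
have dxE := derive1_x B _ _ _ _ _ Delta_gt0 Bv0 cf cg ch S W S_C1 S_pos S_unb
  W0 W_pos diss x xi solution.
split; [|split=> //].
- have [C C0 limC] := limit_set_near (n := n) (p := p) D Delta Delta_gt0.
  apply: edist_inf_cvg0 => e e0.
  have C1 : 0 < C + 1 by rewrite ltr_wpDl.
  have e2 : 0 < e / 2 by rewrite divr_gt0.
  have k0 : 0 < e / 2 / (C + 1) by rewrite divr_gt0.
  have [T1 _ xiT] := xi_to0 _ e2; have [T2 _ zT] := z_to_cube _ k0.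
  exists (Num.max T1 T2) => t; rewrite ge_max => /andP[tT1 tT2].
  have [x' x'lim xx'] := limC (x t) _ (ltW k0)
    ltac:(by rewrite /relative kron_tr; exact: zT).
  exists (x', 0) => //; rewrite prod_normE /= gt_max; apply/andP; split.
    apply: (le_lt_trans xx'); apply: (@le_lt_trans _ _ (e / 2)); last by lra.
    by rewrite mulrCA ger_pMr// ler_pdivrMr// mul1r lerDl.
  rewrite subr0; apply: (@le_lt_trans _ _ (e / 2)); last by lra.
  exact: xiT.
- apply/cvgrPdist_le => e e0; have [T T0 hT] := h_to0 _ e0.
  rewrite near_withinE; exists T; split; first exact: num_real.
  move=> t Tt [dx cv]; have t0 : 0 < t := le_lt_trans T0 Tt.
  (* [derive1_x] asks for continuity of the stacked copies of [v] at [t], which follows entrywise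
     from that of [v]. *)
  rewrite dxE//; last first.
    apply: cvg_mx => s j.
    have -> : (fun u => kron_col (const_mx 1 : 'cV[R]_N) (v u) s j) =
        (fun u => v u (tagnat.sig2 s) j).
      by apply/funext => u; rewrite !mxE mul1r.
    rewrite !mxE mul1r; exact: cvg_entry.
  by rewrite addrK sub0r normrN hT// ltW.
Qed.
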